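(* Let $\mathbf\Omega\colon\mathbb G\to\mathbb G$ be the operator constructed in the context. Given a nonexpansive linear operator $T\colon X\to Y$ between separable Banach spaces, there exist linear isometric embeddings $i\colon X\to\mathbb G$ and $j\colon Y\to\mathbb G$ such that $\mathbf\Omega\circ i=j\circ T$.
   Context: All Banach spaces are real. An operator is a bounded linear operator; nonexpansive means of norm $\le 1$. An $\varepsilon$-embedding is a linear operator $f\colon X\to Y$ with $(1+\varepsilon)^{-1}\|x\|\le\|f(x)\|\le\|x\|$ for all $x\in X$. The Gurarii space $\mathbb G$ is the unique (up to linear isometry) separable Banach space such that, given finite-dimensional Banach spaces $X\subseteq Y$ and $\varepsilon>0$, every isometric embedding $i\colon X\to\mathbb G$ extends to an $\varepsilon$-embedding $j\colon Y\to\mathbb G$. Rational spaces and operators. A rational Banach space is a finite-dimensional Banach space $X$ together with a linear isomorphism $h\colon\mathbb R^n\to X$ such that $\|x\|=\max_{i<k}|f_i(x)|$ for finitely many linear functionals $f_0,\dots,f_{k-1}$ on $X$ with $f_i(h(\mathbb Q^n))\subseteq\mathbb Q$; the vectors in $h(\mathbb Q^n)$ are called rational. A linear operator between rational Banach spaces is rational if it has norm $\le1$ and maps rational vectors to rational vectors. A rational embedding is a rational operator that is isometric. Construction. Let $U,V$ be disjoint real vector spaces, each with a fixed countably infinite vector basis; rational vectors of $U$ (of $V$) are the rational linear combinations of the basis. A rational subspace of $U$ (of $V$) is a finite-dimensional subspace spanned by rational vectors, endowed with a norm that is rational with respect to the rational vectors it contains. Let $\mathcal F$ be the countable family of all triples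 $\langle T,e,k\rangle$, where $k$ is a natural number, $T\colon X\to Y$ is a rational operator between rational subspaces $X$ of $U$ and $Y$ of $V$, and $e=(i,j)$ is a pair of rational embeddings $i\colon X_0\to X$, $j\colon Y_0\to Y$ whose domains $X_0$, $Y_0$ are rational subspaces of $U$, $V$ respectively. Enumerate $\mathcal F$ as $\{\langle T_n,e_n,k_n\rangle\}_{n\in\omega}$, $e_n=(i_n,j_n)$, so that each triple occurs infinitely often. Define rational operators $F_n\colon U_n\to V_n$ between rational subspaces of $U$ and $V$ recursively. Put $U_0=0$, $V_0=0$, $F_0=0$. For $n>0$ consider the condition ($*$): $k:=k_n<n$, the domain of $i_n$ is $U_k$, the domain of $j_n$ is $V_k$ (with their norms), and $T_n\circ i_n=j_n\circ F_k$. If ($*$) fails, put $F_n=F_{n-1}$, $U_n=U_{n-1}$, $V_n=V_{n-1}$. If ($*$) holds, with $i_n\colon U_k\to X$, $j_n\colon V_k\to Y$, let $U_n$ be a rational subspace of $U$ containing $U_{n-1}$ isometrically (by a rational embedding) which, together with a rational embedding $i'\colon X\to U_n$, is a pushout (in the category of Banach spaces with operators of norm $\le 1$) of $i_n\colon U_k\to X$ and the inclusion $U_k\subseteq U_{n-1}$ (so $i'\circ i_n$ is the identity on $U_k$); similarly let $V_n\supseteq V_{n-1}$ with $j'\colon Y\to V_n$ be such a pushout of $j_n\colon V_k\to Y$ and $V_k\subseteq V_{n-1}$, realized as a rational subspace of $V$. Let $F_n\colon U_n\to V_n$ be the unique operator extending $F_{n-1}$ with $F_n\circ i'=j'\circ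 T_n$. (The pushout of $i\colon Z\to X$ and $f\colon Z\to Y$ is $(X\oplus_1 Y)/\{(i(z),-f(z)):z\in Z\}$ with the canonical maps.) Let $U_\infty$, $V_\infty$ be the completions of $\bigcup_n U_n$, $\bigcup_n V_n$, and let $\mathbf\Omega\colon U_\infty\to V_\infty$ be the unique continuous extension of $\bigcup_n F_n$. Both $U_\infty$ and $V_\infty$ are linearly isometric to $\mathbb G$, so $\mathbf\Omega$ is regarded as an operator $\mathbf\Omega\colon\mathbb G\to\mathbb G$. *)

(* Defs.v *)
From HB Require Import structures.
From mathcomp Require Import all_boot all_order all_algebra.
From mathcomp Require Import all_classical all_reals all_analysis.

Set Implicit Arguments.
Unset Strict Implicit.
Unset Printing Implicit Defensive.

Import Order.TTheory GRing.Theory Num.Theory.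
Import numFieldNormedType.Exports.

Local Open Scope classical_set_scope.
Local Open Scope ring_scope.

(* Partial maps defined on a subspace are represented by total functions whose
   values outside of the subspace are irrelevant: every condition below only
   looks at values on the subspace, and equality of spaces and of maps is
   [same_space] and [same_map]. *)

Definition separable (T : topologicalType) : Prop :=
  exists2 D : set T, countable D & dense D.

Definition linear_on (R : realType) (W E : lmodType R) (X : W -> Prop)
    (f : W -> E) : Prop :=
  forall (a : R) x y, X x -> X y -> f (a *: x + y) = a *: f x + f y.

Definition same_map (W E : Type) (X : W -> Prop) (f g : W -> E) : Prop :=
  forall x, X x -> f x = g x.

Section BanachSpaces.
Variable R : realType.

Definition nonexpansive (X Y : normedModType R) (T : X -> Y) : Prop :=
  forall x, `|T x| <= `|x|.

Definition norm_preserving (X Y : normedModType R) (T : X -> Y) : Prop :=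
  forall x, `|T x| = `|x|.

Definition eps_embedding (X Y : normedModType R) (eps : R) (f : X -> Y) :
    Prop :=
  forall x, (1 + eps)^-1 * `|x| <= `|f x| /\ `|f x| <= `|x|.

Definition finite_dimensional (E : lmodType R) : Prop :=
  exists (n : nat) (v : 'I_n -> E),
    forall x, exists c : 'I_n -> R, x = \sum_(i < n) c i *: v i.

(* An inclusion of Banach spaces X <= Y is given as a norm-preserving linear
   map [e]. *)
Definition gurarii (G : completeNormedModType R) : Prop :=
  separable G /\
  forall (X Y : completeNormedModType R) (e : {linear X -> Y}) (eps : R)
      (i : {linear X -> G}),
    finite_dimensional X -> finite_dimensional Y -> norm_preserving e ->
    0 < eps -> norm_preserving i ->
    exists j : {linear Y -> G},
      eps_embedding eps j /\ forall x, j (e x) = i x.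

End BanachSpaces.

Section RationalSubspaces.
Variables (R : realType) (W : lmodType R).

Definition is_basis (b : nat -> W) : Prop :=
  (forall (n : nat) (c : nat -> R),
     \sum_(i < n) c i *: b i = 0 -> forall i, (i < n)%N -> c i = 0) /\
  (forall w, exists (n : nat) (c : nat -> R), w = \sum_(i < n) c i *: b i).

Definition rational_vector (b : nat -> W) : set W :=
  [set w | exists (n : nat) (c : nat -> rat),
     w = \sum_(i < n) ratr (c i) *: b i].

Definition span_of (n : nat) (v : 'I_n -> W) : set W :=
  [set w | exists c : 'I_n -> R, w = \sum_(i < n) c i *: v i].

(* The empty maximum is 0, so k = 0 is possible for the zero space only. *)
Definition rational_norm (b : nat -> W) (X : W -> Prop) (N : W -> R) : Prop :=
  exists (k : nat) (f : 'I_k -> W -> R^o),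
    [/\ forall i, linear_on X (f i),
        forall i x, X x -> rational_vector b x ->
          exists q : rat, f i x = ratr q
      & forall x, X x -> N x = \big[Num.max/0]_(i < k) `|f i x| ].

(* The remaining norm axioms follow from [rational_norm]. *)
Record rational_subspace (b : nat -> W) := RationalSubspace {
  rs_carrier :> W -> Prop ;
  rs_norm : W -> R ;
  rs_spanned : exists (n : nat) (v : 'I_n -> W),
    (forall i, rational_vector b (v i)) /\ rs_carrier = span_of v ;
  rs_rational_norm : rational_norm b rs_carrier rs_norm ;
  rs_norm_eq0 : forall x, rs_carrier x -> rs_norm x = 0 -> x = 0
}.

Variable b : nat -> W.
Implicit Types X Y Z P : rational_subspace b.

Definition same_space X Y : Prop :=
  rs_carrier X = rs_carrier Y /\ same_map X (rs_norm X) (rs_norm Y).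

Definition isometric_subspace X Y : Prop :=
  rs_carrier X `<=` rs_carrier Y /\ same_map X (rs_norm X) (rs_norm Y).

Definition nonexpansive_on X (E : normedModType R) (g : W -> E) : Prop :=
  linear_on X g /\ forall x, X x -> `|g x| <= rs_norm X x.

(* The universal property of the square  p \o i = q \o f  with i : Z -> X,
   f : Z -> Y, p : X -> P, q : Y -> P, in the category of Banach spaces and
   operators of norm <= 1. *)
Definition is_pushout Z X Y P (i f p q : W -> W) : Prop :=
  (forall z, Z z -> p (i z) = q (f z)) /\
  forall (E : completeNormedModType R) (g h : W -> E),
    nonexpansive_on X g -> nonexpansive_on Y h ->
    (forall z, Z z -> g (i z) = h (f z)) ->
    let mediating w := [/\ nonexpansive_on P w,
      forall x, X x -> w (p x) = g x & forall y, Y y -> w (q y) = h y] in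
    exists w : W -> E,
      mediating w /\ forall w', mediating w' -> same_map P w w'.

(* [E], with [eta], is a completion of the union of the chain [S] *)
Definition is_completion (S : nat -> rational_subspace b)
    (E : completeNormedModType R) (eta : W -> E) : Prop :=
  [/\ linear_on (\bigcup_n rs_carrier (S n)) eta,
      forall n x, S n x -> `|eta x| = rs_norm (S n) x
    & dense (eta @` \bigcup_n rs_carrier (S n))].

End RationalSubspaces.

Section RationalOperators.
Variables (R : realType) (U V : lmodType R) (bU : nat -> U) (bV : nat -> V).

Definition rational_operator (X : rational_subspace bU)
    (Y : rational_subspace bV) (T : U -> V) : Prop :=
  [/\ forall x, X x -> Y (T x),
      linear_on X T,
      forall x, X x -> rs_norm Y (T x) <= rs_norm X x
    & forall x, X x -> rational_vector bU x -> rational_vector bV (T x)].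

Definition rational_embedding (X : rational_subspace bU)
    (Y : rational_subspace bV) (T : U -> V) : Prop :=
  rational_operator X Y T /\ forall x, X x -> rs_norm Y (T x) = rs_norm X x.

End RationalOperators.

Section Construction.
Variables (R : realType) (U V : lmodType R) (bU : nat -> U) (bV : nat -> V).

Record triple := Triple {
  tr_X : rational_subspace bU ;
  tr_Y : rational_subspace bV ;
  tr_X0 : rational_subspace bU ;
  tr_Y0 : rational_subspace bV ;
  tr_T : U -> V ;
  tr_i : U -> U ;
  tr_j : V -> V ;
  tr_k : nat ;
  tr_T_rational : rational_operator tr_X tr_Y tr_T ;
  tr_i_rational : rational_embedding tr_X0 tr_X tr_i ;
  tr_j_rational : rational_embedding tr_Y0 tr_Y tr_j
}.

Definition same_triple (s t : triple) : Prop :=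
  [/\ [/\ same_space (tr_X s) (tr_X t), same_space (tr_Y s) (tr_Y t),
          same_space (tr_X0 s) (tr_X0 t) & same_space (tr_Y0 s) (tr_Y0 t)],
      same_map (tr_X s) (tr_T s) (tr_T t),
      same_map (tr_X0 s) (tr_i s) (tr_i t),
      same_map (tr_Y0 s) (tr_j s) (tr_j t)
    & tr_k s = tr_k t].

Definition enumeration (t : nat -> triple) : Prop :=
  forall (s : triple) (N : nat), exists2 n, (N <= n)%N & same_triple (t n) s.

Variables (t : nat -> triple) (Us : nat -> rational_subspace bU)
  (Vs : nat -> rational_subspace bV) (Fs : nat -> U -> V).

Definition amalgamation_condition (n : nat) : Prop :=
  let k := tr_k (t n) in
  [/\ (k < n)%N,
      same_space (tr_X0 (t n)) (Us k),
      same_space (tr_Y0 (t n)) (Vs k)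
    & forall x, Us k x -> tr_T (t n) (tr_i (t n) x) = tr_j (t n) (Fs k x)].

Definition unchanged_step (n : nat) : Prop :=
  [/\ same_space (Us n) (Us n.-1), same_space (Vs n) (Vs n.-1)
    & same_map (Us n) (Fs n) (Fs n.-1)].

Definition amalgamation_step (n : nat) : Prop :=
  let k := tr_k (t n) in
  exists (i' : U -> U) (j' : V -> V),
    [/\ [/\ isometric_subspace (Us n.-1) (Us n),
            rational_embedding (tr_X (t n)) (Us n) i'
          & is_pushout (Us k) (tr_X (t n)) (Us n.-1) (Us n)
              (tr_i (t n)) id i' id],
        [/\ isometric_subspace (Vs n.-1) (Vs n),
            rational_embedding (tr_Y (t n)) (Vs n) j'
          & is_pushout (Vs k) (tr_Y (t n)) (Vs n.-1) (Vs n)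
              (tr_j (t n)) id j' id],
        same_map (Us n.-1) (Fs n) (Fs n.-1)
      & forall x, tr_X (t n) x -> Fs n (i' x) = j' (tr_T (t n) x)].

Record construction : Prop := {
  construction_rational : forall n, rational_operator (Us n) (Vs n) (Fs n) ;
  construction_U0 : rs_carrier (Us 0) = [set 0] ;
  construction_V0 : rs_carrier (Vs 0) = [set 0] ;
  construction_unchanged : forall n, (0 < n)%N ->
    ~ amalgamation_condition n -> unchanged_step n ;
  construction_amalgamated : forall n, (0 < n)%N ->
    amalgamation_condition n -> amalgamation_step n
}.

End Construction.

(* Main.v *)
(* Only the commutation of the pushout squares is needed, not their universal
   property. Enumerate dense sequences of X and Y into x_l in X + Y (with norm
   |.|_X + |.|_Y) and put y_l = T x_l on X, y_l = x_l on Y; it suffices to find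
   a_l in Uoo such that x_l |-> a_l and y_l |-> Omega a_l are isometric. These
   are limits of almost isometric choices of a_0, ..., a_(n-1) in some U_k. To
   pass from n to n + 1, extend U_k and V_k by n + 1 new basis vectors, with
   norms given by finitely many rational functionals, so that the new vectors
   are almost isometric to the x_l (resp. y_l) and the l-th one is close to a_l
   (resp. F_k a_l). Hahn-Banach provides the functionals, and adding to those
   on U_k the pullbacks of those on V_k makes the obvious operator between the
   two extensions nonexpansive. The resulting triple occurs in the enumeration,
   and its pushout square embeds the extensions into the chains. *)

Require Import Defs.
From HB Require Import structures.
From mathcomp Require Import all_boot all_order all_algebra.
From mathcomp Require Import all_classical all_reals all_analysis.
From mathcomp Require Import ring lra.

Set Implicit Arguments.
Unset Strict Implicit.
Unset Printing Implicit Defensive.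

Import Order.TTheory GRing.Theory Num.Theory.
Import numFieldNormedType.Exports.

Local Open Scope classical_set_scope.
Local Open Scope ring_scope.

(** * Seminorms and Helly's theorem *)

(** Seminorms rather than norms: the auxiliary function [P'] in the proof of [helly] may degenerate
    when [delta] is 0. *)
Definition seminorm (R : realType) (W : lmodType R) (P : W -> R) : Prop :=
  (forall x y, P (x + y) <= P x + P y) /\
  (forall a x, P (a *: x) = `|a| * P x).

Section Seminorms.
Variables (R : realType) (W : lmodType R) (P : W -> R).
Hypothesis semiP : seminorm P.

Lemma seminorm0 : P 0 = 0.
Proof. by rewrite -(scale0r 0) semiP.2 normr0 mul0r. Qed.

Lemma seminormN x : P (- x) = P x.
Proof. by rewrite -scaleN1r semiP.2 normrN1 mul1r. Qed.

Lemma seminorm_ge0 x : 0 <= P x.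
Proof.
have := semiP.1 x (- x); rewrite subrr seminorm0 seminormN.
by rewrite -mulr2n pmulrn_lge0.
Qed.

Lemma seminorm_sum n (v : 'I_n -> W) : P (\sum_(l < n) v l) <= \sum_(l < n) P (v l).
Proof.
elim/big_rec2: _ => [|l s w _ le_ws]; first by rewrite seminorm0.
by apply: le_trans (semiP.1 _ _) _; rewrite lerD2l.
Qed.

(* A functional is recorded by its values [r] on the points [z]. *)
Definition dominated (n : nat) (z : nat -> W) (r : nat -> R) : Prop :=
  forall c : nat -> R,
    `|\sum_(l < n) c l * r l| <= P (\sum_(l < n) c l *: z l).

(** One-dimensional step of Hahn-Banach. By the triangle inequality every lower bound for the value
    at [z n] lies below every upper bound, so the supremum [s] of the lower bounds fits. Dividing by
    [c n] reduces to coefficient 1 at [z n]. *)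
Lemma dominated_step n z r : dominated n z r ->
  exists s, forall c : nat -> R,
    `|\sum_(l < n) c l * r l + c n * s| <= P (\sum_(l < n.+1) c l *: z l).
Proof.
move=> dom.
pose L (c : nat -> R) := \sum_(l < n) c l * r l.
pose Z (c : nat -> R) := \sum_(l < n) c l *: z l.
pose lo := [set - L c - P (Z c + z n) | c in [set: nat -> R]].
have ub c' : ubound lo (P (Z c' + z n) - L c').
  move=> _ [c _ <-].
  have domB : L c' - L c <= P (Z c' - Z c).
    have -> : L c' - L c = \sum_(l < n) (c' l - c l) * r l.
      by rewrite -sumrB; apply: eq_bigr => l _; rewrite mulrBl.
    have -> : Z c' - Z c = \sum_(l < n) (c' l - c l) *: z l.
      by rewrite -sumrB; apply: eq_bigr => l _; rewrite scalerBl.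
    by apply: le_trans (dom (fun l => c' l - c l)); rewrite ler_norm.
  have : P (Z c' - Z c) <= P (Z c' + z n) + P (Z c + z n).
    rewrite -(seminormN (Z c + z n)); apply: le_trans (semiP.1 _ _).
    by rewrite opprD addrACA subrr addr0.
  by lra.
pose s := sup lo.
have lo_s c : - L c - P (Z c + z n) <= s.
  apply: ub_le_sup; last by exists c.
  by exists (P (Z (fun=> 0) + z n) - L (fun=> 0)).
have s_up c : s <= P (Z c + z n) - L c.
  apply: ge_sup (ub c).
  by exists (- L (fun=> 0) - P (Z (fun=> 0) + z n)); exists (fun=> 0).
have main c : `|L c + s| <= P (Z c + z n).
  by rewrite ler_norml; have := lo_s c; have := s_up c; lra.
exists s => c; rewrite big_ord_recr /=.
have [-> |cn0] := eqVneq (c n) 0; first by rewrite mul0r scale0r !addr0.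
have -> : \sum_(l < n) c l * r l + c n * s = c n * (L (fun l => c l / c n) + s).
  rewrite mulrDr mulr_sumr; congr (_ + _); apply: eq_bigr => l _.
  by rewrite mulrA mulrCA mulfV // mulr1.
have -> : \sum_(l < n) c l *: z l + c n *: z n =
    c n *: (Z (fun l => c l / c n) + z n).
  rewrite scalerDr scaler_sumr; congr (_ + _); apply: eq_bigr => l _.
  by rewrite scalerA mulrCA mulfV // mulr1.
by rewrite normrM semiP.2 ler_wpM2l.
Qed.

(** The points may be linearly dependent: domination makes the values respect every linear relation,
    so no basis has to be chosen. *)
Lemma hahn_banach n m z r : dominated n z r ->
  exists r', (forall l, (l < n)%N -> r' l = r l) /\ dominated (n + m) z r'.
Proof.
move=> dom; elim: m => [|m [r' [r'r dom']]]; first by exists r; rewrite addn0.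
have [s sP] := dominated_step dom'.
exists (fun l => if (l < n + m)%N then r' l else s); split=> [l ltln|c].
  by rewrite (leq_trans ltln (leq_addr _ _)) r'r.
rewrite addnS big_ord_recr /= ltnn; apply: le_trans (sP c).
rewrite le_eqVlt; apply/orP; left; apply/eqP; congr (`|_ + _|).
by apply: eq_bigr => l _; rewrite ltn_ord.
Qed.

End Seminorms.

(* Helly's theorem: Hahn-Banach on [W * R^n] with the l1-norm, scaled by
   [delta], on the second factor, starting from the points [(z l, - e l)]. *)
Lemma helly (R : realType) (W : lmodType R) (P : W -> R) (n m : nat)
    (e : nat -> W) (A : nat -> nat -> R) (r : nat -> R) (delta : R) :
  seminorm P -> 0 <= delta ->
  (forall w : nat -> R, `|\sum_(l < n) w l * r l| <=
     P (\sum_(l < n) w l *: \sum_(j < m) A l j *: e j)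
     + delta * \sum_(l < n) `|w l|) ->
  exists s, dominated P m e s /\
    forall l, (l < n)%N -> `|\sum_(j < m) A l j * s j - r l| <= delta.
Proof.
move=> semiP delta_ge0 rP.
pose P' (x : W * {ffun 'I_n -> R^o}) := P x.1 + delta * \sum_(l < n) `|x.2 l|.
have semiP' : seminorm P'.
  split=> [x y|a x]; rewrite /P' /=.
    rewrite addrACA -mulrDr lerD ?semiP.1 // ler_wpM2l // -big_split /=.
    by apply: ler_sum => l _; rewrite ffunE ler_normD.
  rewrite semiP.2 mulrDr; congr (_ + _); rewrite mulrCA; congr (_ * _).
  by rewrite mulr_sumr; apply: eq_bigr => l _; rewrite ffunE normrM.
pose d (l : nat) : {ffun 'I_n -> R^o} := [ffun k : 'I_n => (k == l :> nat)%:R].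
  
(* The first [n] points carry the prescribed values [r]; the values of the extension at the points
   [(e j, 0)] are the desired [s j]. *)
pose z l := if (l < n)%N then (\sum_(j < m) A l j *: e j, - d l) else (e (l - n)%N, 0).
have zl (c : nat -> R) : \sum_(l < n) c l *: z l =
    (\sum_(l < n) c l *: \sum_(j < m) A l j *: e j,
     - [ffun k : 'I_n => c k] : {ffun 'I_n -> R^o}).
  rewrite [LHS]surjective_pairing !raddf_sum /=; congr pair.
    by apply: eq_bigr => l _; rewrite /z ltn_ord.
  apply/ffunP => k; rewrite sum_ffunE !ffunE (bigD1 k) //= big1 ?addr0 => [|l lk].
    by rewrite /z ltn_ord !ffunE eqxx scalerN /= -[_ *: _]/(_ * _) mulr1.
  by move: lk; rewrite -val_eqE eq_sym /z ltn_ord !ffunE => /negPf ->; rewrite oppr0 scaler0.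
have zr (c : nat -> R) : \sum_(j < m) c (n + j)%N *: z (n + j)%N =
    (\sum_(j < m) c (n + j)%N *: e j, 0).
  rewrite [LHS]surjective_pairing !raddf_sum /=; congr pair.
    by apply: eq_bigr => l _; rewrite /z ltnNge leq_addr /= addKn.
  by rewrite big1 // => l _; rewrite /z ltnNge leq_addr /= scaler0.
have dom : dominated P' n z r.
  move=> c; apply: le_trans (rP c) _; rewrite zl /P' /= lerD2l ler_wpM2l //.
  by apply: ler_sum => l _; rewrite !ffunE normrN.
have [r' [r'r dom']] := hahn_banach semiP' m dom.
pose s j := r' (n + j)%N.
have key (a c : nat -> R) : `|\sum_(l < n) a l * r l + \sum_(j < m) c j * s j| <=
    P (\sum_(l < n) a l *: \sum_(j < m) A l j *: e j + \sum_(j < m) c j *: e j)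
    + delta * \sum_(l < n) `|a l|.
  pose c' l := if (l < n)%N then a l else c (l - n)%N.
  have c'l (l : 'I_n) : c' l = a l by rewrite /c' ltn_ord.
  have c'r j : c' (n + j)%N = c j by rewrite /c' ltnNge leq_addr /= addKn.
  have := dom' c'; rewrite !big_split_ord /= zl zr /P' /=.
  have -> : \sum_(l < n) c' l * r' l = \sum_(l < n) a l * r l.
    by apply: eq_bigr => l _; rewrite c'l r'r.
  have -> : \sum_(j < m) c' (n + j)%N * r' (n + j)%N = \sum_(j < m) c j * s j.
    by apply: eq_bigr => j _; rewrite c'r.
  have -> : \sum_(l < n) c' l *: \sum_(j < m) A l j *: e j =
      \sum_(l < n) a l *: \sum_(j < m) A l j *: e j.
    by apply: eq_bigr => l _; rewrite c'l.
  have -> : \sum_(j < m) c' (n + j)%N *: e j = \sum_(j < m) c j *: e j.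
    by apply: eq_bigr => j _; rewrite c'r.
  congr (_ <= _ + delta * _); apply: eq_bigr => l _.
  by rewrite !ffunE c'l addr0 normrN.

exists s; split=> [c|l ltln].
  have := key (fun=> 0) c.
  under eq_bigr do rewrite mul0r.
  under [\sum_(l < n) _ *: _]eq_bigr do rewrite scale0r.
  by rewrite !sumr_const normr0 !mul0rn !add0r mulr0 addr0.
(* With coefficient -1 at the [l]-th prescribed point and [A l j] at [e j], the argument of [P]
   cancels and only [delta] remains on the right. *)
pose dd k : R := - (k == l)%:R.
have dl (i : 'I_n) : i != Ordinal ltln -> dd i = 0.
  by rewrite /dd -val_eqE /= => /negPf ->; rewrite oppr0.
have dl1 : dd l = -1 by rewrite /dd eqxx.
have := key dd (A l).
have -> : \sum_(k < n) dd k * r k = - r l.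
  rewrite (bigD1 (Ordinal ltln)) //= dl1 mulN1r big1 ?addr0 // => i /dl ->.
  by rewrite mul0r.
have -> : \sum_(k < n) dd k *: \sum_(j < m) A k j *: e j = - \sum_(j < m) A l j *: e j.
  rewrite (bigD1 (Ordinal ltln)) //= dl1 scaleN1r -[RHS]addr0; congr (_ + _).
  by rewrite big1 // => i /dl ->; rewrite scale0r.
have -> : \sum_(k < n) `|dd k| = 1.
  rewrite (bigD1 (Ordinal ltln)) //= dl1 normrN1 big1 ?addr0 // => i /dl ->.
  by rewrite normr0.
by rewrite addNr seminorm0 // add0r mulr1 addrC.
Qed.

(** The net is the grid of points [k / M - 1] with [k <= 2 * M], of mesh [1 / M <= eta]; every
    coordinate is rounded down. *)
Lemma unit_cube_net (R : realType) (m : nat) (eta : R) : 0 < eta ->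
  exists (I : finType) (g : I -> nat -> R), forall c : nat -> R,
    (forall l, (l < m)%N -> `|c l| <= 1) ->
    exists i, forall l, (l < m)%N -> `|c l - g i l| <= eta.
Proof.
move=> eta_gt0; pose M := (Num.truncn eta^-1).+1.
have M_gt0 : 0 < M%:R :> R by rewrite ltr0n.
have etaV_gt0 : 0 < eta^-1 by rewrite invr_gt0.
have leM : M%:R^-1 <= eta.
  rewrite -[leRHS]invrK lef_pV2 ?posrE ?invr_gt0 //.
  by have /andP[_ /ltW] := truncn_itv (ltW etaV_gt0).
exists {ffun 'I_m -> 'I_(2 * M).+1}.
exists (fun (i : {ffun 'I_m -> 'I_(2 * M).+1}) l =>
  if insub l is Some k then (i k)%:R / M%:R - 1 else 0) => c c1.
exists [ffun k : 'I_m => inord (Num.truncn ((c k + 1) * M%:R))] => l ltlm.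
rewrite (insubT (fun k => (k < m)%N) ltlm) /= ffunE /=.
have /andP[c_ge c_le] : -1 <= c l <= 1 by rewrite -ler_norml c1.
have y_ge0 : 0 <= (c l + 1) * M%:R by rewrite mulr_ge0 ?(ltW M_gt0) //; lra.
have /andP[le_y lt_y] := truncn_itv y_ge0.
rewrite inordK; last first.
  rewrite ltnS -(ler_nat R); apply: le_trans le_y _.
  by rewrite natrM ler_wpM2r ?ler0n //; lra.
apply: le_trans leM.
have -> : c l - ((Num.truncn ((c l + 1) * M%:R))%:R / M%:R - 1) =
    ((c l + 1) * M%:R - (Num.truncn ((c l + 1) * M%:R))%:R) / M%:R.
  by field; rewrite gt_eqF.
rewrite normrM normfV (gtr0_norm M_gt0) ler_piMl ?invr_ge0 ?(ltW M_gt0) //.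
by rewrite ger0_norm ?subr_ge0 // lerBlDl natr1 ltW.
Qed.

(** Take a norming functional at each point of a fine net of the unit cube of coefficients. By
    homogeneity it suffices to treat coefficients of l1-norm 1, which lie in the cube. *)
Lemma norming_family (R : realType) (W : lmodType R) (P : W -> R) (m : nat)
    (x : nat -> W) (eps : R) :
  seminorm P -> 0 < eps ->
  exists (I : finType) (s : I -> nat -> R), (forall i, dominated P m x (s i)) /\
    forall c : nat -> R, exists i, P (\sum_(l < m) c l *: x l) <=
      `|\sum_(l < m) c l * s i l| + eps * \sum_(l < m) `|c l|.
Proof.
move=> semiP eps_gt0; pose B := \sum_(l < m) P (x l) + 1.
have B_gt0 : 0 < B.
  by rewrite ltr_wpDl ?ltr01 ?sumr_ge0 // => l _; apply: seminorm_ge0.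
(* With this mesh, moving to a net point changes [P], and any functional dominated by it, by at most
   [eps / 2]. *)
have eta_gt0 : 0 < eps / (2 * B) by rewrite divr_gt0 ?mulr_gt0.
have [I [g gP]] := unit_cube_net m eta_gt0.
have /choice[s sP] (i : I) : exists s, dominated P m x s /\
    \sum_(l < m) g i l * s l = P (\sum_(l < m) g i l *: x l).
  (* A single constraint with [delta] equal to 0: the functional attains [P] exactly at the net
     point. *)
  have [|s [doms sg]] := @helly R W P 1 m x (fun=> g i)
    (fun=> P (\sum_(l < m) g i l *: x l)) 0 semiP (lexx 0).
    move=> w; rewrite !big_ord1 mul0r addr0 normrM semiP.2.
    by rewrite (ger0_norm (seminorm_ge0 semiP _)).
  exists s; split=> //.
  by have := sg 0%N isT; rewrite normr_le0 subr_eq0 => /eqP.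
exists I, s; split=> [i|c]; first by have [] := sP i.
have small (d : nat -> R) : (forall l, (l < m)%N -> `|d l| <= eps / (2 * B)) ->
    P (\sum_(l < m) d l *: x l) <= eps / 2.
  move=> d_le; apply: le_trans (seminorm_sum semiP _) _.
  apply: (@le_trans _ _ (\sum_(l < m) eps / (2 * B) * P (x l))).
    by apply: ler_sum => l _; rewrite semiP.2 ler_wpM2r ?seminorm_ge0 ?d_le.
  rewrite -mulr_sumr (_ : eps / 2 = eps / (2 * B) * B); last by field; rewrite gt_eqF.
  by rewrite ler_wpM2l ?(ltW eta_gt0) // lerDl.
have unit (c' : nat -> R) : (forall l, (l < m)%N -> `|c' l| <= 1) ->
    exists i, P (\sum_(l < m) c' l *: x l) <= `|\sum_(l < m) c' l * s i l| + eps.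
  move=> /gP[i ig]; exists i; have [dom_i gi] := sP i.
  have d1 := small _ ig.
  have -> : \sum_(l < m) c' l *: x l =
      \sum_(l < m) g i l *: x l + \sum_(l < m) (c' l - g i l) *: x l.
    by rewrite -big_split; apply: eq_bigr => l _; rewrite /= -scalerDl subrKC.
  apply: le_trans (semiP.1 _ _) _; rewrite -gi.
  have := le_trans (dom_i (fun l => c' l - g i l)) d1.
  under eq_bigr do rewrite mulrBl.
  by rewrite sumrB /= ler_norml; have := ler_norm (\sum_(l < m) c' l * s i l); lra.
have [t0|tn0] := eqVneq (\sum_(l < m) `|c l|) 0.
  have c0 (l : 'I_m) : c l = 0.
    by apply/normr0_eq0/(psumr_eq0P _ t0).
  (* All coefficients vanish, so any index serves; the net provides one. *)
  have [i _] : exists i : I, True.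
    by have [l _|i _] := gP (fun=> 0); [rewrite normr0 | exists i].
  exists i; rewrite t0 mulr0 addr0 big1 ?seminorm0 // => l _.
  by rewrite c0 scale0r.
set t := \sum_(l < m) _ in tn0 *.
have t_gt0 : 0 < t by rewrite lt_def tn0 sumr_ge0.
have [l ltlm|i iP] := unit (fun l => c l / t).
  rewrite normrM normfV (gtr0_norm t_gt0) ler_pdivrMr // mul1r.
  by rewrite /t (bigD1 (Ordinal ltlm)) //= lerDl sumr_ge0.
exists i.
have -> : \sum_(l < m) c l *: x l = t *: \sum_(l < m) (c l / t) *: x l.
  by rewrite scaler_sumr; apply: eq_bigr => l _; rewrite scalerA mulrCA mulfV ?mulr1.
have -> : \sum_(l < m) c l * s i l = t * \sum_(l < m) (c l / t) * s i l.
  by rewrite mulr_sumr; apply: eq_bigr => l _; rewrite mulrA mulrCA mulfV ?mulr1.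
by rewrite semiP.2 normrM (gtr0_norm t_gt0) (mulrC eps) -mulrDr ler_pM2l.
Qed.

(** * Rational approximation of seminorms *)

(** Rounding towards 0: absolute values do not grow, so a combination of functionals whose
    coefficients have l1-norm at most 1 keeps this property after rounding. *)
Lemma rat_approx (R : realType) (x eps : R) : 0 < eps ->
  exists q : rat, `|ratr q| <= `|x| /\ `|x - ratr q| <= eps.
Proof.
move=> eps_gt0.
have pos (y : R) : 0 < y -> exists q : rat,
    [/\ 0 <= ratr q :> R, ratr q <= y & y - ratr q <= eps].
  move=> y_gt0; have [|q] := @rat_in_itvoo R (Num.max 0 (y - eps)) y.
    by rewrite gt_max y_gt0 ltrBlDr ltrDl.
  rewrite in_itv /= gt_max => /andP[/andP[q_gt0 q_gt] q_lt].
  by exists q; split; [exact: ltW|exact: ltW|rewrite lerBlDr -lerBlDl ltW].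
case: (ltrgtP x 0) => [x_lt0|x_gt0|->]; last first.
- by exists 0; rewrite rmorph0 subrr normr0; split=> //; rewrite ltW.
- have [q [q_ge0 q_le xq]] := pos x x_gt0.
  exists q; rewrite (ger0_norm q_ge0) gtr0_norm //; split=> //.
  by rewrite ger0_norm ?subr_ge0.
have [q [q_ge0 q_le xq]] := pos (- x) (etrans (oppr_gt0 _) x_lt0).
exists (- q); rewrite rmorphN normrN (ger0_norm q_ge0) ltr0_norm //; split=> //.
by rewrite opprK -normrN opprD ger0_norm ?subr_ge0 // addrC.
Qed.

Lemma sum_delta (R : realType) (W : lmodType R) (m : nat) (v : nat -> W) l :
  (l < m)%N -> \sum_(j < m) (j == l :> nat)%:R *: v j = v l.
Proof.
move=> ltlm; rewrite (bigD1 (Ordinal ltlm)) //= eqxx scale1r big1 ?addr0 // => j.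
by rewrite -val_eqE /= => /negPf ->; rewrite scale0r.
Qed.

(** * Linear algebra in rational subspaces *)

Section RationalSubspaceTheory.
Variables (R : realType) (W : lmodType R) (b : nat -> W) (X : rational_subspace b).

Lemma rs_lin a x y : X x -> X y -> X (a *: x + y).
Proof.
have [n [v [_ ->]]] := rs_spanned X => -[c ->] [d ->].
exists (fun i => a * c i + d i); rewrite scaler_sumr -big_split /=.
by apply: eq_bigr => i _; rewrite scalerDl scalerA.
Qed.

Lemma rs0 : X 0.
Proof.
have [n [v [_ ->]]] := rs_spanned X.
by exists (fun=> 0); rewrite big1 // => i _; rewrite scale0r.
Qed.

Lemma rsZ a x : X x -> X (a *: x).
Proof. by move=> Xx; rewrite -[_ *: _]addr0; apply: rs_lin Xx rs0. Qed.

Lemma rsD x y : X x -> X y -> X (x + y).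
Proof. by move=> Xx Xy; rewrite -[x]scale1r; apply: rs_lin. Qed.

Lemma rsB x y : X x -> X y -> X (x - y).
Proof. by move=> Xx Xy; rewrite addrC -scaleN1r; apply: rs_lin. Qed.

Lemma rs_sum n (c : nat -> R) (v : nat -> W) :
  (forall l, (l < n)%N -> X (v l)) -> X (\sum_(l < n) c l *: v l).
Proof.
move=> Xv; elim/big_ind: _ => [|x y Xx Xy|l _]; [exact: rs0|exact: rsD|].
exact/rsZ/Xv.
Qed.

Lemma rs_norm_ge0 x : X x -> 0 <= rs_norm X x.
Proof.
by have [k [f [_ _ normX]]] := rs_rational_norm X; move=> /normX ->; apply: bigmax_ge_id.
Qed.

Variables (E : lmodType R) (f : W -> E).
Hypothesis lin_f : linear_on X f.

Lemma linear_on0 : f 0 = 0.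
Proof.
have := lin_f 1 rs0 rs0; rewrite !scale1r addr0 => /esym/eqP.
by rewrite -subr_eq0 addrK => /eqP.
Qed.

Lemma linear_onD x y : X x -> X y -> f (x + y) = f x + f y.
Proof. by move=> Xx Xy; rewrite -[x in LHS]scale1r lin_f // scale1r. Qed.

Lemma linear_onZ a x : X x -> f (a *: x) = a *: f x.
Proof.
by move=> Xx; rewrite -[a *: x]addr0 lin_f ?linear_on0 ?addr0 //; apply: rs0.
Qed.

Lemma linear_on_sum n (c : nat -> R) (v : nat -> W) :
  (forall l, (l < n)%N -> X (v l)) ->
  f (\sum_(l < n) c l *: v l) = \sum_(l < n) c l *: f (v l).
Proof.
elim: n => [|n IHn] Xv; first by rewrite !big_ord0 linear_on0.
have Xv' l : (l < n)%N -> X (v l) by move=> /ltnW; apply: Xv.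
rewrite !big_ord_recr /= linear_onD ?linear_onZ ?IHn //; try exact: Xv.
- exact: rs_sum.
- exact/rsZ/Xv.
Qed.

End RationalSubspaceTheory.

Lemma dominated_widen (R : realType) (W : lmodType R) (P : W -> R) (n m : nat)
    (z : nat -> W) (r : nat -> R) :
  (n <= m)%N -> dominated P m z r -> dominated P n z r.
Proof.
move=> le_nm dom c; pose c' l := if (l < n)%N then c l else 0.
have -> : \sum_(l < n) c l * r l = \sum_(l < m) c' l * r l.
  rewrite (big_ord_widen m (fun l => c l * r l) le_nm) big_mkcond.
  by apply: eq_bigr => l _; rewrite /c'; case: ifP => // _; rewrite mul0r.
have -> : \sum_(l < n) c l *: z l = \sum_(l < m) c' l *: z l.
  rewrite (big_ord_widen m (fun l => c l *: z l) le_nm) big_mkcond.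
  by apply: eq_bigr => l _; rewrite /c'; case: ifP => // _; rewrite scale0r.
exact: dom.
Qed.

(** * Finite families of rational functionals *)

Section ApproximatingFamilies.
Variables (R : realType) (W : lmodType R) (b : nat -> W) (X : rational_subspace b).
Variables (n m : nat) (a : nat -> W).
Variables (L : lmodType R) (P : L -> R) (x : nat -> L).

(* [(h.1, h.2)] stands for the functional [h.1] on [X] extended to the sum of
   [X] and [m] new vectors by the values [h.2]. *)
Record compatible (delta eps : R) (h : (W -> R) * (nat -> R)) : Prop := {
  compatible_linear : linear_on X (h.1 : W -> R^o) ;
  compatible_rational : forall u, X u -> rational_vector b u ->
    exists q : rat, h.1 u = ratr q ;
  compatible_rational_new : forall l, exists q : rat, h.2 l = ratr q ;
  compatible_norm : forall u, X u -> `|h.1 u| <= rs_norm X u ;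
  compatible_new : forall c : nat -> R, `|\sum_(l < m) c l * h.2 l| <=
    P (\sum_(l < m) c l *: x l) + eps * \sum_(l < m) `|c l| ;
  compatible_close : forall l, (l < n)%N -> `|h.1 (a l) - h.2 l| <= delta }.

(** The error is additive and relative to the l1-norm of the coefficients, so the [x l] may be
    linearly dependent while the vectors that approximate them are independent. *)
Definition almost_isometric (eps : R) : Prop := forall c : nat -> R,
  `|rs_norm X (\sum_(l < n) c l *: a l) - P (\sum_(l < n) c l *: x l)|
    <= eps * \sum_(l < n) `|c l|.

(** Lower bounds complementing the upper bounds in [compatible]: the maximum of the functionals
    recovers the norm of [X] and, up to [eps], [P] on the new vectors. The last field provides
    nonzero multiples of the new coordinates, so that the maximum vanishes only at 0. *)
Record norming (eps : R) (I : finType) (h : I -> (W -> R) * (nat -> R)) : Prop := {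
  norming_old : forall u, X u ->
    rs_norm X u <= \big[Num.max/0]_i `|(h i).1 u| ;
  norming_new : forall c : nat -> R, P (\sum_(l < m) c l *: x l) <=
    \big[Num.max/0]_i `|\sum_(l < m) c l * (h i).2 l|
    + eps * \sum_(l < m) `|c l| ;
  norming_separates : forall l, (l < m)%N -> exists i (r : R), [/\ r != 0,
    forall u, (h i).1 u = 0 & forall k, (h i).2 k = r * (k == l)%:R] }.

(** Three kinds of functionals are collected: [hB] extends those defining the norm of [X] to the new
    vectors, [hC] extends norming functionals of [P] to [X], and [hD] consists of small multiples of
    the new coordinates. The extra [eps] in [delta + eps] pays for rounding to rational values. *)
Lemma approximating_family (delta eps : R) :
  seminorm P -> (n <= m)%N -> 0 <= delta -> 0 < eps ->
  (forall l, (l < n)%N -> X (a l)) ->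
  almost_isometric delta ->
  exists (I : finType) (h : I -> (W -> R) * (nat -> R)),
    (forall i, compatible (delta + eps) eps (h i)) /\ norming eps h.
Proof.
move=> semiP le_nm delta_ge0 eps_gt0 Xa near_a.
have [k [f [lin_f rat_f normX]]] := rs_rational_norm X.
have f_le i u : X u -> `|f i u| <= rs_norm X u.
  by move=> Xu; rewrite normX //; apply: (le_bigmax _ (fun i => `|f i u|)).
have tri (A B : R) : `|B| <= `|A| + `|A - B|.
  by rewrite -[B in `|B|](subKr A); apply: ler_normB.
have chain (A B C D : R) : `|A - B| <= eps / 2 -> `|B - C| <= delta ->
    `|C - D| <= eps / 2 -> `|A - D| <= delta + eps.
  rewrite !ler_norml => /andP[? ?] /andP[? ?] /andP[? ?]; lra.
have perturb (s r : nat -> R) (eta : R) : 0 <= eta ->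
    (forall l, `|s l - r l| <= eta) ->
    forall c : nat -> R, `|\sum_(l < m) c l * s l - \sum_(l < m) c l * r l|
      <= eta * \sum_(l < m) `|c l|.
  move=> eta_ge0 sr c; rewrite -sumrB mulr_sumr.
  apply: le_trans (ler_norm_sum _ _ _) _; apply: ler_sum => l _.
  by rewrite -mulrBr normrM mulrC ler_wpM2r.
(* Helly's condition for the values [f i (a l)] at [x l] holds because the combination of the [a l]
   has norm at most that of the [x l] plus the error [delta]. *)
have /choice[hB hBP] (i : 'I_k) : exists h, compatible (delta + eps) eps h /\
    h.1 = f i.
  have [|s [dom_s s_f]] := @helly R L P n m x (fun l j => (j == l)%:R)
      (fun l => f i (a l)) delta semiP delta_ge0.
    move=> c; rewrite -[X in `|X|](linear_on_sum (lin_f i)) //.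
    apply: le_trans (f_le _ _ _) _; first exact: rs_sum.
    have -> : \sum_(l < n) c l *: \sum_(j < m) (j == l :> nat)%:R *: x j =
        \sum_(l < n) c l *: x l.
      by apply: eq_bigr => l _; rewrite sum_delta // (leq_trans _ le_nm).
    by rewrite -lerBlDl; apply: le_trans (near_a c); rewrite ler_norm.
  have /choice[r rP] l := rat_approx (s l) eps_gt0.
  exists (f i, fun l => ratr (r l)); split=> //; split=> //=.
  - by move=> u Xu; apply: rat_f.
  - by move=> l; exists (r l).
  - by move=> u Xu; apply: f_le.
  - move=> c; apply: le_trans (tri (\sum_(l < m) c l * s l) _) _.
    apply: lerD; first exact: dom_s.
    apply: (perturb s (fun l => ratr (r l))) => [|l]; first exact: ltW.
    by have [] := rP l.
  - move=> l ltln; have := s_f l ltln.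
    rewrite -[\sum_(j < m) _]/(\sum_(j < m) (j == l :> nat)%:R *: (s j : R^o)).
    rewrite sum_delta ?(leq_trans ltln) // distrC => s_l.
    rewrite -[f i (a l) - _](subrKA (s l)); apply: le_trans (ler_normD _ _) _.
    by rewrite lerD //; have [] := rP l.
(* Bounds the values [f j (a l)]: changing coefficients by at most [eps / 2 / A0] moves the
   combination of the [f j] at [a l] by at most [eps / 2]. The summand 1 makes it positive. *)
pose A0 := \sum_(l < n) \sum_(j < k) `|f j (a l)| + 1.
have A0_gt0 : 0 < A0.
  by rewrite ltr_wpDl ?ltr01 // sumr_ge0 // => l _; apply: sumr_ge0.
have [IC [s [dom_s norm_s]]] := norming_family m x semiP (divr_gt0 eps_gt0 (ltr0n R 2)).
(* The functionals [f j] embed [X] isometrically into R^k with the maximum norm [Q]. *)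
pose Q (v : {ffun 'I_k -> R^o}) := \big[Num.max/0]_(j < k) `|v j|.
have semiQ : seminorm Q.
  split=> [u v|c v].
    apply: bigmax_le => [|j _]; first by rewrite addr_ge0 // bigmax_ge_id.
    rewrite ffunE; apply: le_trans (ler_normD _ _) _.
    by rewrite lerD // (le_bigmax _ (fun j => `|_ j|)).
  rewrite /Q (big_morph (fun y => `|c| * y) (id1 := 0) (op1 := Num.max)).
  - by apply: eq_bigr => j _; rewrite ffunE normrM.
  - by move=> y z; rewrite maxr_pMr.
  - by rewrite mulr0.
pose d (j : nat) : {ffun 'I_k -> R^o} := [ffun i : 'I_k => (i == j :> nat)%:R].
have sum_d (c : nat -> R) (i : 'I_k) : (\sum_(j < k) c j *: d j) i = c i.
  rewrite sum_ffunE (bigD1 i) //= big1 ?addr0 => [|j ji]; rewrite !ffunE.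
    by rewrite eqxx -[_ *: _]/(_ * _) mulr1.
  by rewrite val_eqE eq_sym (negPf ji) scaler0.
(* Applying Helly in R^k instead of [X] yields a combination of the [f j] with coefficients [lam],
   which stays rational on rational vectors once the coefficients are rounded. *)
have /choice[hC hCP] (i : IC) : exists h, compatible (delta + eps) eps h /\
    forall l, `|s i l - h.2 l| <= eps / 2.
  have [|lam [dom_lam s_lam]] := @helly R _ Q n k d
      (fun l j => if insub j is Some j' then f j' (a l) else 0) (s i) delta semiQ delta_ge0.
    move=> c; apply: le_trans (dominated_widen le_nm (dom_s i) c) _.
    have := near_a c; rewrite distrC => /(le_trans (ler_norm _)).
    rewrite lerBlDl => /le_trans; apply; rewrite lerD2r normX; last exact: rs_sum.
    rewrite le_eqVlt; apply/orP; left; apply/eqP; apply: eq_bigr => j _.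
    rewrite (linear_on_sum (lin_f j)) // sum_ffunE; congr `|_|.
    apply: eq_bigr => l _; rewrite ffunE; congr (_ *: _).
    by rewrite (sum_d (fun j => if insub j is Some j' then f j' (a l) else 0)) valK.
  (* Domination by the maximum norm, tested on the signs of [lam], bounds the l1-norm of [lam]. *)
  have lam_le1 : \sum_(j < k) `|lam j| <= 1.
    have := dom_lam (fun j => Num.sg (lam j)).
    under eq_bigr do rewrite -normrEsg.
    move=> /(le_trans (ler_norm _))/le_trans; apply; apply: bigmax_le => // j _.
    by rewrite (sum_d (fun j => Num.sg (lam j))) normr_sg lern1 leq_b1.
  have eta_gt0 : 0 < eps / 2 / A0 by rewrite !divr_gt0.
  have /choice[r rP] l := rat_approx (s i l) (divr_gt0 eps_gt0 (ltr0n R 2)).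
  have /choice[q qP] j := rat_approx (lam j) eta_gt0.
  exists (fun u => \sum_(j < k) ratr (q j) * f j u, fun l => ratr (r l)).
  split=> [|l]; last by have [] := rP l.
  split=> /=.
  - move=> c u v Xu Xv; rewrite scaler_sumr -big_split /=.
    apply: eq_bigr => j _; rewrite lin_f // mulrDr; congr (_ + _).
    by rewrite -[c *: f j u]/(c * f j u) mulrCA.
  - move=> u Xu ru; have /choice[g gP] j := rat_f j u Xu ru.
    exists (\sum_(j < k) q j * g j); rewrite rmorph_sum /=.
    by apply: eq_bigr => j _; rewrite rmorphM /= gP.
  - by move=> l; exists (r l).
  - move=> u Xu; apply: le_trans (ler_norm_sum _ _ _) _.
    apply: (@le_trans _ _ (\sum_(j < k) `|lam j| * rs_norm X u)).
      apply: ler_sum => j _; rewrite normrM ler_pM ?f_le //.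
      by have [] := qP j.
    by rewrite -mulr_suml ler_piMl ?rs_norm_ge0.
  - move=> c; apply: le_trans (tri (\sum_(l < m) c l * s i l) _) _.
    apply: lerD; first exact: dom_s.
    apply: le_trans (perturb (s i) (fun l => ratr (r l)) (eps / 2) _ _ c) _.
    + by rewrite divr_ge0 // ltW.
    + by move=> l; have [] := rP l.
    by rewrite ler_wpM2r ?sumr_ge0 // ler_pdivrMr // ler_peMr ?ltW // ltr1n.
  - move=> l ltln; have := s_lam l ltln.
    have -> : \sum_(j < k) (if insub (j : nat) is Some j' then f j' (a l) else 0) * lam j
        = \sum_(j < k) lam j * f j (a l).
      by apply: eq_bigr => j _; rewrite valK mulrC.
    have lam_q : `|\sum_(j < k) ratr (q j) * f j (a l)
        - \sum_(j < k) lam j * f j (a l)| <= eps / 2.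
      rewrite -sumrB; apply: le_trans (ler_norm_sum _ _ _) _.
      apply: (@le_trans _ _ (eps / 2 / A0 * \sum_(j < k) `|f j (a l)|)).
        rewrite mulr_sumr; apply: ler_sum => j _; rewrite -mulrBl normrM.
        by rewrite ler_wpM2r // distrC; have [] := qP j.
      rewrite -mulrA ler_piMr ?divr_ge0 ?(ltW eps_gt0) // mulrC ler_pdivrMr // mul1r.
      rewrite /A0 (bigD1 (Ordinal ltln)) //= -addrA lerDl addr_ge0 //.
      by apply: sumr_ge0 => i' _; apply: sumr_ge0.
    by move=> s_l; apply: chain lam_q s_l (rP l).2.
have [e [e_neq0 e_le]] : exists e : rat, ratr e != 0 :> R /\ `|ratr e| <= eps :> R.
  have [e] := @rat_in_itvoo R 0 eps eps_gt0; rewrite in_itv /= => /andP[e_gt0 e_lt].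
  by exists e; rewrite gt_eqF // gtr0_norm // ltW.
(* As [e] is at most [eps] in absolute value, the error terms allowed in [compatible] absorb this
   functional. *)
pose hD (l : 'I_m) : (W -> R) * (nat -> R) := (fun=> 0, fun j => ratr e * (j == l :> nat)%:R).
have hDP l : compatible (delta + eps) eps (hD l).
  split=> /=.
  - by move=> c u v _ _; rewrite scaler0 addr0.
  - by exists 0; rewrite rmorph0.
  - by move=> j; exists (e * (j == l :> nat)%:R); rewrite rmorphM /= rmorph_nat.
  - by move=> u Xu; rewrite normr0 normX // bigmax_ge_id.
  - move=> c; rewrite (bigD1 l) //= eqxx mulr1 big1 ?addr0 => [|j]; last first.
      by rewrite -val_eqE /= => /negPf ->; rewrite !mulr0.
    apply: (@le_trans _ _ (eps * \sum_(j < m) `|c j|)); last first.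
      by rewrite lerDr seminorm_ge0.
    by rewrite normrM mulrC ler_pM // (bigD1 l) //= lerDl sumr_ge0.
  - move=> j _; rewrite sub0r normrN normrM.
    apply: (@le_trans _ _ `|ratr e|); first by rewrite ler_piMr // normr_nat lern1 leq_b1.
    by apply: le_trans e_le _; rewrite lerDr.
exists ('I_k + IC + 'I_m)%type, (fun i => match i with
  | inl (inl j) => hB j | inl (inr j) => hC j | inr l => hD l end).
split=> [[[i|i]|l]|].
- by have [] := hBP i.
- by have [] := hCP i.
- exact: hDP.
split.
- move=> u Xu; rewrite {1}normX //; apply: bigmax_le => [|i _]; first exact: bigmax_ge_id.
  rewrite -(hBP i).2.
  exact: (le_bigmax _ (fun i : 'I_k + IC + 'I_m => `|(match i with
    | inl (inl j) => hB j | inl (inr j) => hC j | inr l => hD l end).1 u|) (inl (inl i))).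
- move=> c; have [i /le_trans] := norm_s c; apply.
  have [cmp_i s_i] := hCP i.
  pose F (j : 'I_k + IC + 'I_m) := match j with
    | inl (inl j) => hB j | inl (inr j) => hC j | inr l => hD l end.
  have := le_bigmax 0 (fun j => `|\sum_(l < m) c l * (F j).2 l|) (inl (inr i)).
  have eps2_ge0 : 0 <= eps / 2 by rewrite divr_ge0 // ltW.
  have := perturb (s i) (hC i).2 (eps / 2) eps2_ge0 s_i c; rewrite distrC.
  have := tri (\sum_(l < m) c l * (hC i).2 l) (\sum_(l < m) c l * s i l).
  by rewrite /F /=; lra.
- by move=> l ltlm; exists (inr (Ordinal ltlm)), (ratr e); split.
Qed.
End ApproximatingFamilies.

(** * Sums of a rational subspace with new basis vectors *)

Lemma linear_pack (R : realType) (X Y : lmodType R) (f : X -> Y) :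
  (forall a x y, f (a *: x + y) = a *: f x + f y) ->
  exists g : {linear X -> Y}, forall x, g x = f x.
Proof.
move=> lin_f; pose m := GRing.isLinear.Build R X Y *:%R f lin_f.
pose g : {linear X -> Y} := HB.pack f m.
by exists g.
Qed.

(** The coordinate functionals of [b]. The expansion may be cut at any bound of the support, so one
    [N] can serve several vectors and two spaces. *)
Record coordinates (R : realType) (W : lmodType R) (b : nat -> W)
    (co : nat -> {linear W -> R^o}) : Prop := {
  coordinate_basis : forall i j, co i (b j) = (i == j)%:R ;
  coordinate_support : forall w, exists n, forall i, (n <= i)%N -> co i w = 0 ;
  coordinate_sum : forall w n, (forall i, (n <= i)%N -> co i w = 0) ->
    w = \sum_(i < n) co i w *: b i }.

(** Independence makes the finitely supported coefficient sequence of a vector unique, and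
    uniqueness makes it linear in the vector. *)
Lemma coordinates_exist (R : realType) (W : lmodType R) (b : nat -> W) :
  is_basis b -> exists co, coordinates b co.
Proof.
move=> [free_b span_b].
have widen n m (c : nat -> R) : (n <= m)%N -> (forall i, (n <= i)%N -> c i = 0) ->
    \sum_(i < m) c i *: b i = \sum_(i < n) c i *: b i.
  move=> le_nm c0; rewrite (big_ord_widen m (fun i => c i *: b i) le_nm) [RHS]big_mkcond.
  by apply: eq_bigr => i _; case: ltnP => // /c0 ->; rewrite scale0r.
have uniq n m (c d : nat -> R) :
    (forall i, (n <= i)%N -> c i = 0) -> (forall i, (m <= i)%N -> d i = 0) ->
    \sum_(i < n) c i *: b i = \sum_(i < m) d i *: b i -> c =1 d.
  move=> c0 d0; rewrite -(widen _ _ _ (leq_maxl n m) c0) -(widen _ _ _ (leq_maxr n m) d0).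
  move=> /eqP; rewrite -subr_eq0 -sumrB => /eqP; under eq_bigr do rewrite -scalerBl.
  move=> /(free_b _ (fun i => c i - d i)) cd i.
  have [/cd/eqP|] := ltnP i (maxn n m); first by rewrite subr_eq0 => /eqP.
  by rewrite geq_max => /andP[/c0 -> /d0 ->].
have /choice[f /choice[n fn]] w : exists c : nat -> R, exists n : nat,
    (forall i, (n <= i)%N -> c i = 0) /\ w = \sum_(i < n) c i *: b i.
  have [n [c ->]] := span_b w; exists (fun i => if (i < n)%N then c i else 0), n.
  split=> [i|]; first by rewrite leqNgt => /negPf ->.
  by apply: eq_bigr => i _; rewrite ltn_ord.
have f_eq w m (c : nat -> R) : (forall i, (m <= i)%N -> c i = 0) ->
    w = \sum_(i < m) c i *: b i -> f w =1 c.
  by move=> c0 wE; have [f0 wf] := fn w; apply: uniq f0 c0 _; rewrite -wf.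
have lin_f i a x y : f (a *: x + y) i = a *: (f x i : R^o) + f y i.
  have [fx0 xE] := fn x; have [fy0 yE] := fn y.
  apply: (f_eq _ (maxn (n x) (n y)) (fun i => a * f x i + f y i)) => [j|].
    by rewrite geq_max => /andP[/fx0 -> /fy0 ->]; rewrite mulr0 addr0.
  under eq_bigr do rewrite scalerDl -scalerA.
  by rewrite big_split /= -scaler_sumr
      (widen _ _ _ (leq_maxl _ _) fx0) (widen _ _ _ (leq_maxr _ _) fy0) -xE -yE.
have /choice[co coE] i := linear_pack (lin_f i).
exists co; split=> [i j|w|w m w0].
- rewrite coE; apply: (f_eq _ j.+1 (fun i => (i == j)%:R)) => [k ltjk|].
    by rewrite gtn_eqF.
  by rewrite sum_delta.
- by exists (n w) => i /(fn w).1; rewrite coE.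
- have [f0 {1}->] := fn w.
  under [RHS]eq_bigr do rewrite coE.
  have w0' i : (m <= i)%N -> f w i = 0 by move=> /w0; rewrite coE.
  by rewrite -(widen _ _ _ (leq_maxl m (n w)) w0') -(widen _ _ _ (leq_maxr m (n w)) f0).
Qed.

Section Coordinates.
Variables (R : realType) (W : lmodType R) (b : nat -> W).
Variable co : nat -> {linear W -> R^o}.
Hypothesis coP : coordinates b co.

Lemma rational_vectorP w :
  rational_vector b w <-> forall i, exists q : rat, co i w = ratr q.
Proof.
split=> [[n [c ->]] i|].
  exists (\sum_(j < n) c j * (i == j)%:R); rewrite linear_sum rmorph_sum /=.
  apply: eq_bigr => j _; rewrite linearZ /= (coordinate_basis coP) rmorphM /=.
  by rewrite rmorph_nat.
move=> /choice[q qP]; have [n w0] := coordinate_support coP w.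
exists n, q; rewrite {1}(coordinate_sum coP w0).
by apply: eq_bigr => i _; rewrite qP.
Qed.

(** From [N] on, the basis vectors are independent of [X] and can serve as new vectors. *)
Lemma subspace_support (X : rational_subspace b) :
  exists N, forall u, X u -> forall i, (N <= i)%N -> co i u = 0.
Proof.
have [n [v [_ ->]]] := rs_spanned X.
have /choice[N NP] i := coordinate_support coP (v i).
exists (\max_i N i)%N => _ [c ->] i lei; rewrite linear_sum big1 // => j _.
rewrite linearZ /= NP ?scaler0 //; apply: leq_trans lei; exact: leq_bigmax.
Qed.

(** For [X] supported below [N], this is on [direct_sum X N m] the projection onto [X] along the new
    vectors. *)
Definition truncation N w : W := \sum_(i < N) co i w *: b i.

Definition direct_sum (X : W -> Prop) N m : W -> Prop :=
  [set w | exists (u : W) (c : nat -> R), X u /\ w = u + \sum_(l < m) c l *: b (N + l)%N].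

Lemma truncation_linear N a x y :
  truncation N (a *: x + y) = a *: truncation N x + truncation N y.
Proof.
rewrite scaler_sumr -big_split /=; apply: eq_bigr => i _.
by rewrite linearP scalerDl scalerA.
Qed.

Section DirectSum.
Variables (X : rational_subspace b) (N m : nat).
Hypothesis X_support : forall u, X u -> forall i, (N <= i)%N -> co i u = 0.

Lemma coordinate_direct_sum u (c : nat -> R) i : X u ->
  co i (u + \sum_(l < m) c l *: b (N + l)%N) =
  if (i < N)%N then co i u else if (i - N < m)%N then c (i - N)%N else 0.
Proof.
move=> Xu; rewrite linearD linear_sum /=.
under eq_bigr do rewrite linearZ /= (coordinate_basis coP).
case: ltnP => [ltiN|leNi].
  rewrite big1 ?addr0 // => l _; rewrite ltn_eqF ?mulr0 ?scaler0 //.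
  exact: leq_trans ltiN (leq_addr _ _).
rewrite X_support // add0r; case: ltnP => [lt_m|le_m].
  rewrite (bigD1 (Ordinal lt_m)) //= subnKC // eqxx big1 ?addr0 => [|l].
    by rewrite -[_ *: _]/(_ * _) mulr1.
  rewrite -val_eqE /= => /negPf li; suff -> : (i == N + l)%N = false by rewrite scaler0.
  by apply: contraFF li => /eqP ->; rewrite addKn.
rewrite big1 // => l _; suff -> : (i == N + l)%N = false by rewrite scaler0.
apply: contraTF le_m => /eqP ->; rewrite addKn -ltnNge; exact: ltn_ord.
Qed.

Lemma truncation_direct_sum u (c : nat -> R) : X u ->
  truncation N (u + \sum_(l < m) c l *: b (N + l)%N) = u.
Proof.
move=> Xu; rewrite [RHS](coordinate_sum coP (X_support Xu)).
by apply: eq_bigr => i _; rewrite coordinate_direct_sum // ltn_ord.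
Qed.

Lemma direct_sumP w : direct_sum X N m w -> X (truncation N w) /\
  w = truncation N w + \sum_(l < m) co (N + l)%N w *: b (N + l)%N.
Proof.
move=> [u [c [Xu ->]]]; rewrite truncation_direct_sum //; split=> //.
congr (_ + _); apply: eq_bigr => l _; rewrite coordinate_direct_sum //.
by rewrite ltnNge leq_addr addKn ltn_ord.
Qed.

Lemma truncation_rational w : rational_vector b w ->
  rational_vector b (truncation N w).
Proof.
move=> /rational_vectorP/choice[q qP]; exists N, q.
by apply: eq_bigr => i _; rewrite qP.
Qed.

(** The maximum of the extended functionals is a rational norm: compatibility gives linearity and
    rationality, and [norming] gives definiteness. *)
Lemma enlarge (I : finType) (h : I -> (W -> R) * (nat -> R)) (n : nat) a
    (L : lmodType R) (P : L -> R) x delta eps :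
  (forall i, compatible X n m a P x delta eps (h i)) ->
  norming X m P x eps h ->
  exists X' : rational_subspace b, rs_carrier X' = direct_sum X N m /\
    forall u (c : nat -> R), X u ->
      rs_norm X' (u + \sum_(l < m) c l *: b (N + l)%N) =
      \big[Num.max/0]_i `|(h i).1 u + \sum_(l < m) c l * (h i).2 l|.
Proof.
move=> cmp nrm.
pose f i w := (h i).1 (truncation N w) + \sum_(l < m) co (N + l)%N w * (h i).2 l.
pose norm w := \big[Num.max/0]_i `|f i w|.
have fE i u (c : nat -> R) : X u -> f i (u + \sum_(l < m) c l *: b (N + l)%N) =
    (h i).1 u + \sum_(l < m) c l * (h i).2 l.
  move=> Xu; rewrite /f truncation_direct_sum //; congr (_ + _).
  apply: eq_bigr => l _; rewrite coordinate_direct_sum //.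
  by rewrite ltnNge leq_addr addKn ltn_ord.
have spanned : exists (n : nat) (v : 'I_n -> W),
    (forall i, rational_vector b (v i)) /\ direct_sum X N m = span_of v.
  have [d [v [rat_v XE]]] := rs_spanned X.
  exists (d + m)%N, (fun i : 'I_(d + m) =>
    match fintype.split i with inl j => v j | inr l => b (N + l)%N end).
  split=> [i|].
    case: fintype.split => // l; apply/rational_vectorP => j.
    by exists (j == N + l)%N%:R; rewrite (coordinate_basis coP) rmorph_nat.
  apply/funext => w; apply/propext; split.
    move=> [u [c []]]; rewrite XE => -[e ->] ->.
    exists (fun i : 'I_(d + m) => match fintype.split i with inl j => e j | inr l => c l end).
    rewrite big_split_ord /=; congr (_ + _); apply: eq_bigr => i _.
      by rewrite (unsplitK (inl i)).
    by rewrite (unsplitK (inr i)).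
  move=> [e ->]; exists (\sum_(j < d) e (lshift m j) *: v j).
  exists (fun l => if insub l is Some l' then e (rshift d l') else 0).
  split; first by rewrite XE; exists (fun j => e (lshift m j)).
  rewrite big_split_ord /=; congr (_ + _); apply: eq_bigr => i _.
    by rewrite (unsplitK (inl i)).
  by rewrite (unsplitK (inr i)) valK.
have rat_norm : rational_norm b (direct_sum X N m) norm.
  exists #|I|, (fun i => f (enum_val i)); split=> [i c u v Du Dv|i w Dw rat_w|w _].
  - have [[Xu _] [Xv _]] := (direct_sumP Du, direct_sumP Dv).
    rewrite /f truncation_linear (compatible_linear (cmp _)) // scalerDr addrACA.
    congr (_ + _); rewrite scaler_sumr -big_split /=; apply: eq_bigr => l _.
    by rewrite linearP mulrDl -[c *: (_ * _)]/(c * (_ * _)) mulrA.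
  - have [Xw _] := direct_sumP Dw.
    have [q qE] := compatible_rational (cmp (enum_val i)) Xw (truncation_rational rat_w).
    have /choice[r rP] l := compatible_rational_new (cmp (enum_val i)) l.
    have /choice[s sP] := (rational_vectorP w).1 rat_w.
    exists (q + \sum_(l < m) s (N + l)%N * r l); rewrite /f qE rmorphD rmorph_sum /=.
    by congr (_ + _); apply: eq_bigr => l _; rewrite rmorphM /= rP sP.
  - by rewrite /norm (reindex _ (onW_bij _ (@enum_val_bij I))).
have norm_eq0 w : direct_sum X N m w -> norm w = 0 -> w = 0.
  move=> /[dup]/direct_sumP[Xu wE] _ norm0.
  have f0 i : f i w = 0.
    apply/normr0_eq0/le_anti; rewrite normr_ge0 andbT -norm0.
    exact: (le_bigmax _ (fun i => `|f i w|)).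
  set u := truncation N w in Xu wE.
  (* First the separating functionals kill the new coordinates; what is left lies in [X], where
     [norming_old] applies. *)
  have c0 l : (l < m)%N -> co (N + l)%N w = 0.
    move=> ltlm; have [i [r [r_neq0 h1 h2]]] := norming_separates nrm ltlm.
    have := f0 i; rewrite /f h1 add0r (bigD1 (Ordinal ltlm)) //= h2 eqxx mulr1 big1 ?addr0.
      by move=> /eqP; rewrite mulf_eq0 (negPf r_neq0) orbF => /eqP.
    by move=> j; rewrite -val_eqE h2 /= => /negPf ->; rewrite !mulr0.
  have wu : w = u by rewrite wE big1 ?addr0 // => l _; rewrite c0 ?scale0r.
  rewrite wu; apply: (rs_norm_eq0 Xu); apply/eqP; rewrite eq_le rs_norm_ge0 // andbT.
  apply: le_trans (norming_old nrm Xu) _; apply: bigmax_le => // i _.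
  have := f0 i; rewrite /f big1 ?addr0 => [|l _]; last by rewrite c0 ?mul0r.
  by rewrite -/u => ->; rewrite normr0.
exists (RationalSubspace spanned rat_norm norm_eq0); split=> // u c Xu.
by apply: eq_bigr => i _; rewrite fE.
Qed.

End DirectSum.
End Coordinates.

(** * Metric properties of the enlarged space *)

Section Amalgam.
Variables (R : realType) (W : lmodType R) (b : nat -> W).
Variable co : nat -> {linear W -> R^o}.
Hypothesis coP : coordinates b co.
Variables (X : rational_subspace b) (N m : nat).
Hypothesis X_support : forall u, X u -> forall i, (N <= i)%N -> co i u = 0.
Variables (X' : rational_subspace b) (I : finType) (h : I -> (W -> R) * (nat -> R)).
Hypothesis X'_sum : rs_carrier X' = direct_sum b X N m.
Hypothesis X'_norm : forall u (c : nat -> R), X u ->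
  rs_norm X' (u + \sum_(l < m) c l *: b (N + l)%N) =
  \big[Num.max/0]_i `|(h i).1 u + \sum_(l < m) c l * (h i).2 l|.
Variables (n : nat) (a : nat -> W) (L : lmodType R) (P : L -> R) (x : nat -> L).
Variables (delta eps : R).
Hypothesis h_compatible : forall i, compatible X n m a P x delta eps (h i).
Hypothesis h_norming : norming X m P x eps h.

Lemma amalgam_old u : X u -> X' u.
Proof.
move=> Xu; rewrite X'_sum; exists u, (fun=> 0); split=> //.
by rewrite big1 ?addr0 // => l _; rewrite scale0r.
Qed.

Lemma amalgam_new l : (l < m)%N -> X' (b (N + l)%N).
Proof.
move=> ltlm; rewrite X'_sum; exists 0, (fun j => (j == l)%:R); split; first exact: rs0.
by rewrite add0r (sum_delta (fun j => b (N + j)%N)).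
Qed.

Lemma amalgam_norm_old u : X u -> rs_norm X' u = rs_norm X u.
Proof.
move=> Xu.
have -> : rs_norm X' u = \big[Num.max/0]_i `|(h i).1 u|.
  have := X'_norm (fun=> 0) Xu.
  under eq_bigr do rewrite scale0r; rewrite big1 // addr0 => ->.
  by apply: eq_bigr => i _; rewrite big1 ?addr0 // => l _; rewrite mul0r.
apply/eqP; rewrite eq_le (norming_old h_norming Xu) andbT.
apply: bigmax_le => [|i _]; last exact: compatible_norm (h_compatible i) _ Xu.
exact: rs_norm_ge0.
Qed.

Lemma amalgam_embedding : rational_embedding X X' id.
Proof.
split; last exact: amalgam_norm_old.
by split=> // [u|u /amalgam_norm_old ->]; first exact: amalgam_old.
Qed.

(** No functional exceeds [P] by more than the error, and by [norming_new] their maximum falls short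
    of [P] by no more than the error. *)
Lemma amalgam_almost_isometric : seminorm P -> 0 <= eps ->
  almost_isometric X' m (fun l => b (N + l)%N) P x eps.
Proof.
move=> semiP eps_ge0 c.
have -> : rs_norm X' (\sum_(l < m) c l *: b (N + l)%N) =
    \big[Num.max/0]_i `|\sum_(l < m) c l * (h i).2 l|.
  rewrite -[X in rs_norm _ X]add0r X'_norm; last exact: rs0.
  apply: eq_bigr => i _.
  rewrite -[(h i).1 0]/((h i).1 0 : R^o).
  by rewrite (linear_on0 (compatible_linear (h_compatible i))) add0r.
rewrite ler_distl; apply/andP; split; first by rewrite lerBlDr (norming_new h_norming).
apply: bigmax_le => [|i _]; last exact: compatible_new (h_compatible i) c.
by rewrite addr_ge0 ?(seminorm_ge0 semiP) ?mulr_ge0 ?sumr_ge0.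
Qed.

Lemma amalgam_close l : (n <= m)%N -> (l < n)%N -> 0 <= delta -> X (a l) ->
  rs_norm X' (b (N + l)%N - a l) <= delta.
Proof.
move=> le_nm ltln delta_ge0 Xal.
have XNal : X (- a l) by rewrite -scaleN1r; apply: rsZ.
have ltlm := leq_trans ltln le_nm.
have -> : b (N + l)%N - a l = - a l + \sum_(j < m) (j == l :> nat)%:R *: b (N + j)%N.
  by rewrite (sum_delta (fun j => b (N + j)%N)) // addrC.
rewrite (X'_norm (fun j => (j == l)%:R)) //; apply: bigmax_le => // i _.
have -> : \sum_(j < m) (j == l :> nat)%:R * (h i).2 j = (h i).2 l.
  exact: (@sum_delta _ R^o).
have -> : (h i).1 (- a l) = - (h i).1 (a l).
  rewrite -scaleN1r; have := linear_onZ (compatible_linear (h_compatible i)) (-1) Xal.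
  by move=> ->; rewrite scaleN1r.
by rewrite -normrN opprD opprK; apply: (compatible_close (h_compatible i)).
Qed.

End Amalgam.

(** * Pulling functionals back along a rational operator *)

Section Pullback.
Variables (R : realType) (U V : lmodType R) (bU : nat -> U) (bV : nat -> V).
Variables (X : rational_subspace bU) (Y : rational_subspace bV) (F : U -> V).
Hypothesis F_rational : rational_operator X Y F.
Variables (n m : nat) (a : nat -> U) (L1 L2 : lmodType R) (P : L1 -> R) (Q : L2 -> R).
Variables (x : nat -> L1) (y : nat -> L2) (delta eps : R).
Hypothesis le_QP : forall c : nat -> R,
  Q (\sum_(l < m) c l *: y l) <= P (\sum_(l < m) c l *: x l).

(** The bounds survive on the old vectors because [F] is nonexpansive, and on the new ones because
    [le_QP] makes the passage from the [x l] to the [y l] nonexpansive. *)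
Lemma compatible_pullback h :
  compatible Y n m (F \o a) Q y delta eps h ->
  compatible X n m a P x delta eps (h.1 \o F, h.2).
Proof.
have [FY lin_F le_F rat_F] := F_rational.
move=> [lin_h rat_h rat_new norm_h new_h close_h]; split=> //=.
- by move=> c u v Xu Xv; rewrite /comp lin_F // lin_h //; apply: FY.
- by move=> u Xu rat_u; apply: rat_h; [apply: FY|apply: rat_F].
- by move=> u Xu; apply: le_trans (norm_h _ _) (le_F _ _); first exact: FY.
- by move=> c; apply: le_trans (new_h c) _; rewrite lerD2r.
Qed.

(** All conditions in [norming] are lower bounds or existence statements, so they persist when
    functionals are added. *)
Lemma norming_sum (I J : finType) (h : I -> (U -> R) * (nat -> R))
    (g : J -> (U -> R) * (nat -> R)) :
  norming X m P x eps h ->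
  norming X m P x eps (fun i : I + J => match i with inl i => h i | inr j => g j end).
Proof.
move=> [old_h new_h sep_h].
have le_max (f : I + J -> R) :
    \big[Num.max/0]_i f (inl i) <= \big[Num.max/0]_i f i.
  by apply: bigmax_le => [|i _]; [exact: bigmax_ge_id|exact: le_bigmax].
split=> [u Xu|c|l /sep_h[i ir]]; last by exists (inl i).
- exact: le_trans (old_h u Xu) (le_max (fun i => `|_ u|)).
- apply: le_trans (new_h c) _; rewrite lerD2r.
  exact: (le_max (fun i => `|\sum_(l < m) _|)).
Qed.

End Pullback.

(** * The inductive step *)

Section Step.
Variables (R : realType) (U V : lmodType R) (bU : nat -> U) (bV : nat -> V).
Hypotheses (bU_basis : is_basis bU) (bV_basis : is_basis bV).
Variable t : nat -> triple bU bV.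
Hypothesis t_enum : enumeration t.
Variables (Us : nat -> rational_subspace bU) (Vs : nat -> rational_subspace bV).
Variable Fs : nat -> U -> V.
Hypothesis UVF_constr : construction t Us Vs Fs.
Variables (L1 L2 : lmodType R) (P : L1 -> R) (Q : L2 -> R).
Hypotheses (semiP : seminorm P) (semiQ : seminorm Q).
Variables (x : nat -> L1) (y : nat -> L2).
Hypothesis le_QP : forall m (c : nat -> R),
  Q (\sum_(l < m) c l *: y l) <= P (\sum_(l < m) c l *: x l).

Record approximation (n : nat) (eps : R) (k : nat) (a : nat -> U) : Prop := {
  approximation_in : forall l, (l < n)%N -> Us k (a l) ;
  approximation_U : almost_isometric (Us k) n a P x eps ;
  approximation_V : almost_isometric (Vs k) n (Fs k \o a) Q y eps }.

(** The triple formed by [S], the two inclusions and [k] is enumerated, and it satisfies the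
    amalgamation condition because [S] extends [Fs k]. The commuting squares carry [S] into the
    chains, fixing [Us k]. *)
Lemma extension_occurs k (X' : rational_subspace bU) (Y' : rational_subspace bV)
    (S : U -> V) :
  rational_operator X' Y' S -> rational_embedding (Us k) X' id ->
  rational_embedding (Vs k) Y' id -> (forall u, Us k u -> S u = Fs k u) ->
  exists n (i : U -> U) (j : V -> V),
    [/\ rational_embedding X' (Us n) i, rational_embedding Y' (Vs n) j,
        forall u, Us k u -> i u = u & forall w, X' w -> Fs n (i w) = j (S w)].
Proof.
move=> S_rat U_emb V_emb SF.
(* Searching from [k.+1] on gives [k < n], as the amalgamation condition demands. *)
have [n ltkn [[[XE XN] [YE YN] X0E Y0E] SE iE jE kE]] :=
  t_enum (Triple k S_rat U_emb V_emb) k.+1.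
rewrite /= in XE XN YE YN X0E Y0E SE iE jE kE.
have [FV _ _ _] := construction_rational UVF_constr k.
have UkX u : Us k u -> X' u by have [[H _ _ _] _] := U_emb; apply: H.
have X0k : rs_carrier (tr_X0 (t n)) = Us k := X0E.1.
have Y0k : rs_carrier (tr_Y0 (t n)) = Vs k := Y0E.1.
have cond : amalgamation_condition t Us Vs Fs n.
  rewrite /amalgamation_condition kE; split=> // u Uu.
  have Xu : tr_X (t n) u by rewrite XE; apply: UkX.
  have Y0u : tr_Y0 (t n) (Fs k u) by rewrite Y0k; apply: FV.
  by rewrite iE ?X0k // (SE _ Xu) (jE _ Y0u) SF.
have n_gt0 : (0 < n)%N by apply: leq_ltn_trans ltkn.
have [i [j [[_ i_emb [i_id _]] [_ j_emb _] _ ij]]] :=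
  construction_amalgamated UVF_constr n_gt0 cond.
rewrite kE in i_id.
(* The enumeration returns the triple only up to [same_triple], so embeddings are transported along
   equality of carriers and norms. *)
have emb (W : lmodType R) (b : nat -> W) (Z Z' X'' : rational_subspace b) (f : W -> W) :
    rs_carrier Z = rs_carrier Z' -> same_map Z (rs_norm Z) (rs_norm Z') ->
    rational_embedding Z X'' f -> rational_embedding Z' X'' f.
  move=> ZE ZN [[fX lin_f le_f rat_f] norm_f].
  split; last by move=> u; rewrite -ZE => Zu; rewrite norm_f // ZN.
  split=> [u|c u v|u|u]; rewrite -ZE; [exact: fX|exact: lin_f| |exact: rat_f].
  by move=> Zu; rewrite -ZN ?le_f.
exists n, i, j; split.
- exact: emb XE XN i_emb.
- exact: emb YE YN j_emb.
- by move=> u Uu; rewrite -[RHS]i_id // iE // X0k.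
- by move=> w Xw; rewrite ij ?XE // SE ?XE.
Qed.

(** The old error [delta] enters only the distance from the old vectors to the new ones; the new
    approximation has error [eps], however small. *)
Lemma approximation_step n delta eps k a :
  0 <= delta -> 0 < eps -> approximation n delta k a ->
  exists k' a', approximation n.+1 eps k' a' /\ forall l, (l < n)%N ->
    [/\ Us k' (a l), Us k' (a' l) & rs_norm (Us k') (a' l - a l) <= delta + eps].
Proof.
move=> delta_ge0 eps_gt0 [Ua near_U near_V].
have F_rat := construction_rational UVF_constr k.
have [FV lin_F _ rat_F] := F_rat.
have [coU coUP] := coordinates_exist bU_basis.
have [coV coVP] := coordinates_exist bV_basis.
have [NU NUP] := subspace_support coUP (Us k).
have [NV NVP] := subspace_support coVP (Vs k).
(* A common bound, so that new vectors with equal indices correspond under [S]. *)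
pose N := maxn NU NV.
have U_supp u : Us k u -> forall i, (N <= i)%N -> coU i u = 0.
  by move=> Uu i; rewrite geq_max => /andP[/(NUP _ Uu)].
have V_supp u : Vs k u -> forall i, (N <= i)%N -> coV i u = 0.
  by move=> Uu i; rewrite geq_max => /andP[_ /(NVP _ Uu)].
have [IU [hU [cmpU nrmU]]] :=
  approximating_family semiP (leqnSn n) delta_ge0 eps_gt0 Ua near_U.
have [IV [hV [cmpV nrmV]]] := approximating_family semiQ (leqnSn n) delta_ge0 eps_gt0
  (fun l ltln => FV _ (Ua l ltln)) near_V.
(* The pullbacks of [hV] make [S] below nonexpansive. *)
pose h (i : IU + IV) := match i with
  | inl i => hU i | inr j => ((hV j).1 \o Fs k, (hV j).2) end.
have cmp i : compatible (Us k) n n.+1 a P x (delta + eps) eps (h i).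
  by case: i => //= j; apply: (compatible_pullback F_rat (le_QP _)).
have nrm : norming (Us k) n.+1 P x eps h by apply: norming_sum.
have [X' [X'E X'N]] := enlarge coUP U_supp cmp nrm.
have [Y' [Y'E Y'N]] := enlarge coVP V_supp cmpV nrmV.
(* [Fs k] on the old part; the new basis vectors of [U] go to those of [V]. *)
pose S w := Fs k (truncation bU coU N w) + \sum_(l < n.+1) coU (N + l)%N w *: bV (N + l)%N.
have SE u (c : nat -> R) : Us k u -> S (u + \sum_(l < n.+1) c l *: bU (N + l)%N) =
    Fs k u + \sum_(l < n.+1) c l *: bV (N + l)%N.
  move=> Uu; rewrite /S (truncation_direct_sum coUP _ U_supp) //; congr (_ + _).
  apply: eq_bigr => l _; rewrite (coordinate_direct_sum coUP _ U_supp) //.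
  by rewrite ltnNge leq_addr addKn ltn_ord.
have S_old u : Us k u -> S u = Fs k u.
  move=> Uu; have := SE u (fun=> 0) Uu.
  rewrite [X in S (_ + X)]big1 => [|l _]; last by rewrite scale0r.
  rewrite [X in _ = _ + X]big1 => [|l _]; last by rewrite scale0r.
  by rewrite !addr0.
have S_new l : (l < n.+1)%N -> S (bU (N + l)%N) = bV (N + l)%N.
  move=> ltl; have := SE 0 (fun j => (j == l)%:R) (rs0 _).
  rewrite (sum_delta (fun j => bU (N + j)%N)) // (sum_delta (fun j => bV (N + j)%N)) //.
  by rewrite (linear_on0 lin_F) !add0r.
have S_rat : rational_operator X' Y' S.
  split.
  - move=> w; rewrite X'E Y'E => -[u [c [Uu ->]]]; rewrite SE //.
    by exists (Fs k u), c; split=> //; apply: FV.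
  - move=> c u v; rewrite X'E.
    move=> /(direct_sumP coUP U_supp)[Uu _] /(direct_sumP coUP U_supp)[Uv _].
    rewrite /S truncation_linear lin_F // scalerDr addrACA; congr (_ + _).
    rewrite scaler_sumr -big_split /=; apply: eq_bigr => l _.
    by rewrite linearP scalerDl scalerA.
  - move=> w; rewrite X'E => -[u [c [Uu ->]]]; rewrite SE // X'N // Y'N; last exact: FV.
    apply: bigmax_le => [|j _]; first exact: bigmax_ge_id.
    exact: (le_bigmax 0 (fun i => `|(h i).1 u + \sum_(l < n.+1) c l * (h i).2 l|) (inr j)).
  - move=> w; rewrite X'E => /(direct_sumP coUP U_supp)[Uu _] rat_w.
    have /(rational_vectorP coVP)/choice[q qP] :=
      rat_F _ Uu (truncation_rational coUP N rat_w).
    have /(rational_vectorP coUP)/choice[r rP] := rat_w.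
    apply/(rational_vectorP coVP) => i.
    exists (q i + \sum_(l < n.+1) r (N + l)%N * (i == N + l)%N%:R).
    rewrite linearD qP linear_sum rmorphD rmorph_sum /=; congr (_ + _).
    apply: eq_bigr => l _.
    by rewrite linearZ /= (coordinate_basis coVP) rmorphM /= rmorph_nat rP.
have U_emb := amalgam_embedding X'E X'N cmp nrm.
have V_emb := amalgam_embedding Y'E Y'N cmpV nrmV.
have [k' [i [j [i_emb j_emb i_id ij]]]] := extension_occurs S_rat U_emb V_emb S_old.
have [[iU lin_i _ _] norm_i] := i_emb.
have [[jV lin_j _ _] norm_j] := j_emb.
have newU l : (l < n.+1)%N -> X' (bU (N + l)%N) by apply: amalgam_new X'E _.
have newV l : (l < n.+1)%N -> Y' (bV (N + l)%N) by apply: amalgam_new Y'E _.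
have oldU u : Us k u -> X' u by apply: amalgam_old X'E _.
have eps_ge0 := ltW eps_gt0.
exists k', (fun l => i (bU (N + l)%N)); split; first split.
- by move=> l /newU/iU.
- move=> c; rewrite -(linear_on_sum lin_i c (v := fun l => bU (N + l)%N)) //.
  rewrite norm_i; last exact: (rs_sum c (v := fun l => bU (N + l)%N)).
  exact: (amalgam_almost_isometric X'N cmp nrm).
- move=> c.
  (* The square turns the images under [Fs k'] into images under [j] of the new vectors of [Y'], and
     [j] is isometric. *)
  have -> : \sum_(l < n.+1) c l *: (Fs k' \o (fun l => i (bU (N + l)%N))) l =
      j (\sum_(l < n.+1) c l *: bV (N + l)%N).
    rewrite (linear_on_sum lin_j c (v := fun l => bV (N + l)%N)) //.
    by apply: eq_bigr => l _; rewrite /= ij ?S_new //; apply: newU.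
  rewrite norm_j; last exact: (rs_sum c (v := fun l => bV (N + l)%N)).
  exact: (amalgam_almost_isometric Y'N cmpV nrmV).
- move=> l ltln; have ltl := leqW ltln.
  have Xal := oldU _ (Ua l ltln); have Xbl := newU l ltl.
  rewrite -(i_id _ (Ua l ltln)); split; [exact: iU|exact: iU|].
  have -> : i (bU (N + l)%N) - i (a l) = i (bU (N + l)%N - a l).
    rewrite addrC -scaleN1r -lin_i //; congr (i _).
    by rewrite scaleN1r addrC.
  rewrite norm_i; last by rewrite addrC -scaleN1r; apply: rs_lin.
  apply: (amalgam_close X'N cmp (leqnSn n)) => //; last exact: Ua.
  by rewrite addr_ge0.
Qed.

End Step.

(** * Passage to the limit *)

Section GeometricLimits.
Variable R : realType.
Local Notation half n := ((2%:R^-1 : R) ^+ n).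

Lemma half_gt0 n : 0 < half n.
Proof. by rewrite exprn_gt0 // invr_gt0. Qed.

Lemma half_small (eps : R) : 0 < eps ->
  exists n0, forall n, (n0 <= n)%N -> half n < eps.
Proof.
move=> eps_gt0; have epsV_gt0 : 0 < eps^-1 by rewrite invr_gt0.
exists (Num.truncn eps^-1).+1 => n le_n.
rewrite exprVn -[ltRHS]invrK ltf_pV2 ?posrE ?exprn_gt0 // -natrX.
have /andP[_ /lt_le_trans] := truncn_itv (ltW epsV_gt0); apply.
by rewrite ler_nat (leq_trans le_n) // ltnW // ltn_expl.
Qed.

(** Replaces limits of real sequences by explicit errors [C * half n]. *)
Lemma le_half_limit (A B C : R) n0 :
  (forall n, (n0 <= n)%N -> A <= B + C * half n) -> A <= B.
Proof.
move=> le_AB; rewrite leNgt; apply/negP => lt_BA.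
have C1_gt0 : 0 < `|C| + 1 by rewrite ltr_wpDl.
have [n1 n1P] := half_small (divr_gt0 (etrans (subr_gt0 _ _) lt_BA) C1_gt0).
have := n1P (maxn n0 n1) (leq_maxr _ _); rewrite ltr_pdivlMr //.
have := le_AB _ (leq_maxl n0 n1); have := half_gt0 (maxn n0 n1).
have := ler_norm C; move: (half _) => h; nra.
Qed.

Lemma eq_half_limit (A B C : R) n0 :
  (forall n, (n0 <= n)%N -> `|A - B| <= C * half n) -> A = B.
Proof.
move=> AB; apply/eqP; rewrite -subr_eq0 -normr_le0.
by apply: (@le_half_limit _ _ C n0) => n /AB; rewrite add0r.
Qed.

Lemma geometric_limit (E : completeNormedModType R) (u : nat -> E) C n0 :
  (forall n, (n0 <= n)%N -> `|u n.+1 - u n| <= C * half n) ->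
  exists w, forall n, (n0 <= n)%N -> `|u n - w| <= 2 * C * half n.
Proof.
move=> du.
have C_ge0 : 0 <= C.
  have := le_trans (normr_ge0 _) (du n0 (leqnn _)).
  by rewrite pmulr_lge0 ?half_gt0.
(* Telescoping form: [C * half (n + k)] equals [2 * C * (half (n + k) - half (n + k).+1)], which
   closes the induction. *)
have tail n k : (n0 <= n)%N -> `|u (n + k)%N - u n| <= 2 * C * (half n - half (n + k)).
  move=> le_n; elim: k => [|k IHk]; first by rewrite addn0 !subrr normr0 mulr0.
  rewrite addnS -(subrKA (u (n + k)%N)); apply: le_trans (ler_normD _ _) _.
  have := du (n + k)%N (leq_trans le_n (leq_addr _ _)); rewrite [half (n + k).+1]exprS.
  by move: IHk; move: (half n) (half (n + k)) => h h'; lra.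
have tail' n m : (n0 <= n)%N -> (n <= m)%N -> `|u m - u n| <= 2 * C * half n.
  move=> le_n /subnKC <-; apply: le_trans (tail _ _ le_n) _.
  rewrite ler_wpM2l ?mulr_ge0 // lerBlDr lerDl ltW // half_gt0.
have cvg_u : cvgn u.
  apply/cauchy_cvgP/cauchy_exP => eps eps_gt0.
  have C2_gt0 : 0 < 2 * C + 1 by rewrite ltr_wpDl ?mulr_ge0.
  have [n1 n1P] := half_small (divr_gt0 eps_gt0 C2_gt0).
  pose n := maxn n0 n1; exists (u n); exists n => // m /= le_nm.
  rewrite -ball_normE /= distrC.
  apply: le_lt_trans (tail' n m (leq_maxl _ _) le_nm) _.
  have := n1P n (leq_maxr _ _); rewrite ltr_pdivlMr //.
  by have := half_gt0 n; move: (half n) => h; nra.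
exists (limn u) => n le_n; apply/ler_addgt0Pl => eps eps_gt0.
have /cvgrPdist_lt/(_ _ eps_gt0)[N _ NP] := cvg_u.
have := NP (maxn n N) (leq_maxr _ _); rewrite /= distrC => uN.
rewrite distrC -(subrKA (u (maxn n N))) (le_trans (ler_normD _ _)) // lerD //.
  by rewrite distrC ltW.
exact: tail' (leq_maxl _ _).
Qed.

End GeometricLimits.

(** * Dense sequences and extension of isometries *)

Lemma separable_sequence (R : realType) (X : normedModType R) : separable X ->
  exists u : nat -> X, forall z eps, 0 < eps -> exists l, `|z - u l| < eps.
Proof.
move=> [D /countable_injP[f f_inj] D_dense].
have approx z eps : 0 < eps -> exists2 d, D d & `|z - d| < eps.
  move=> eps_gt0; have [||d [zd Dd]] := D_dense (ball z eps).
  - by exists z; apply: ballxx.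
  - exact: ball_open.
  - by exists d => //; move: zd; rewrite -ball_normE.
(* Inverts the injection of [D] into the natural numbers, with default value 0 at numbers that are
   not attained. *)
have /choice[u uP] n : exists w : X, forall d, D d -> f d = n -> w = d.
  have [[d [Dd <-]]|noD] := pselect (exists d, D d /\ f d = n).
    by exists d => d' Dd' /esym ff'; apply: f_inj => //; rewrite inE.
  by exists 0 => d Dd fd; case: noD; exists d.
exists u => z eps /(approx z)[d Dd zd].
by exists (f d); rewrite (uP _ d Dd erefl).
Qed.

(** The image of [z] is a point [w] with [|w - a l| <= |z - x l|] for all [l]; linearity and
    preservation of norms pass from the dense sequence to [X]. *)
Lemma isometric_extension (R : realType) (X : normedModType R)
    (E : completeNormedModType R) (x : nat -> X) (a : nat -> E) :
  (forall z eps, 0 < eps -> exists l, `|z - x l| < eps) ->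
  (forall m (c : nat -> R),
    `|\sum_(l < m) c l *: a l| = `|\sum_(l < m) c l *: x l|) ->
  exists i : {linear X -> E}, norm_preserving i /\ forall l, i (x l) = a l.
Proof.
move=> x_dense xa.
pose h n : R := 2%:R^-1 ^+ n; have h_gt0 n : 0 < h n := half_gt0 R n.
(* Combinations of three terms suffice to test linearity. The indices may coincide, hence the sum of
   delta functions. *)
have xa3 (c1 c2 c3 : R) l1 l2 l3 :
    `|c1 *: a l1 + c2 *: a l2 + c3 *: a l3| = `|c1 *: x l1 + c2 *: x l2 + c3 *: x l3|.
  pose m := (maxn l1 (maxn l2 l3)).+1.
  pose c j := c1 * (j == l1)%:R + c2 * (j == l2)%:R + c3 * (j == l3)%:R.
  have sumc (L : lmodType R) (v : nat -> L) :
      \sum_(l < m) c l *: v l = c1 *: v l1 + c2 *: v l2 + c3 *: v l3.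
    under eq_bigr do rewrite !scalerDl -!scalerA.
    by rewrite !big_split /= -!scaler_sumr !sum_delta // /m ltnS !leq_max leqnn ?orbT.
  by rewrite -!sumc xa.
have xa2 l l' : `|a l - a l'| = `|x l - x l'|.
  by have := xa3 1 (-1) 0 l l' 0%N; rewrite !scale0r !addr0 !scaleN1r !scale1r.
have xa1 l : `|a l| = `|x l|.
  by have := xa3 1 0 0 l 0%N 0%N; rewrite !scale0r !addr0 !scale1r.
(* [w] is the limit of [a (s n)] for a sequence [x (s n)] tending to [z]. The constant 5 is 4 for
   the distance to the limit plus 1 for that of [x (s n)] to [z]. *)
have /choice[i iP] z : exists w, forall l, `|w - a l| <= `|z - x l|.
  have /choice[s sP] n := x_dense z (h n) (h_gt0 n).
  have [n _|w wP] := @geometric_limit R E (a \o s) 2 0%N.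
    rewrite /= xa2 -(subrKA z); apply: le_trans (ler_normD _ _) _.
    have := sP n; have := sP n.+1; rewrite (distrC z (x (s n.+1))).
    by rewrite /h exprS; have := h_gt0 n; rewrite /h; move: (_ ^+ n) => k; lra.
  exists w => l; apply: (@le_half_limit R _ _ 5 0%N) => n _.
  have := wP n isT; have := sP n; rewrite -/(h n) => zs /= sw.
  have : `|w - a l| <= `|a (s n) - w| + `|x (s n) - x l|.
    by rewrite -xa2 (distrC (a (s n)) w) ler_distD.
  have : `|x (s n) - x l| <= `|z - x (s n)| + `|z - x l|.
    by rewrite (distrC z (x (s n))) ler_distD.
  by lra.
(* Replacing the three vectors by approximants costs [(2 + |c|) * h n], once in [E] and once in [X],
   where the defect is 0. *)
have lin_i c z z' : i (c *: z + z') = c *: i z + i z'.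
  apply/eqP; rewrite -subr_eq0 -normr_le0.
  apply: (@le_half_limit R _ _ (2 * (2 + `|c|)) 0%N) => n _.
  rewrite add0r -/(h n).
  have [l1 zl1] := x_dense z (h n) (h_gt0 n).
  have [l2 zl2] := x_dense z' (h n) (h_gt0 n).
  have [l3 zl3] := x_dense (c *: z + z') (h n) (h_gt0 n).
  have dev (L : lmodType R) (p q r p' q' r' : L) : p - c *: q - r =
      (p - p') + (p' - c *: q' - r') - c *: (q - q') - (r - r').
    rewrite scalerBr !opprB [(_ - _) + (_ - _ - _)]addrA subrKA.
    by rewrite (addrAC p (- (c *: q'))) subrKA (addrAC p (- r')) subrKA.
  have dev_le (L : normedModType R) (p q r p' q' r' : L) : `|p - c *: q - r| <=
      `|p - p'| + `|p' - c *: q' - r'| + `|c| * `|q - q'| + `|r - r'|.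
    rewrite {1}(dev _ p q r p' q' r') -normrZ (le_trans (ler_normB _ _)) // lerD2r.
    by rewrite (le_trans (ler_normB _ _)) // lerD2r ler_normD.
  have i1 : `|c| * `|i z - a l1| <= `|c| * h n.
    by rewrite ler_wpM2l // (le_trans (iP z l1)) // ltW.
  have x1 : `|c| * `|x l1 - z| <= `|c| * h n by rewrite ler_wpM2l // distrC ltW.
  have i2 := iP z' l2; have i3 := iP (c *: z + z') l3.
  have := dev_le _ (i (c *: z + z')) (i z) (i z') (a l3) (a l1) (a l2).
  have := dev_le _ (x l3) (x l1) (x l2) (c *: z + z') z z'.
  have := xa3 1 (- c) (-1) l3 l1 l2; rewrite !scaleN1r !scale1r !scaleNr => ->.
  have -> : c *: z + z' - c *: z - z' = 0.
    by rewrite (addrAC (c *: z)) subrr add0r subrr.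
  rewrite normr0 (distrC (x l3) (c *: z + z')) (distrC (x l2)) opprD addrA; lra.
have [g gE] := linear_pack lin_i.
exists g; split=> [z|l]; last first.
  by rewrite gE; apply/eqP; rewrite -subr_eq0 -normr_le0 -(normr0 X) -(subrr (x l)) iP.
rewrite gE; apply: (@eq_half_limit R _ _ 2 0%N) => n _.
have [l zl] := x_dense z (h n) (h_gt0 n); rewrite -/(h n).
have := iP z l; have := lerB_dist (i z) (a l); have := lerB_dist (a l) (i z).
have := lerB_dist z (x l); have := lerB_dist (x l) z.
by rewrite (distrC (x l)) (distrC (a l)) xa1 ler_norml; lra.
Qed.

Lemma continuous_linear_lipschitz (R : realType) (E F : normedModType R)
    (f : {linear E -> F}) :
  continuous f -> exists C, forall z, `|f z| <= C * `|z|.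
Proof.
move=> /linear_bounded_continuous/linear_boundedP[M [_ fM]].
by exists (M + 1); apply: fM; rewrite ltrDl.
Qed.

Lemma rs_norm0 (R : realType) (W : lmodType R) (b : nat -> W)
    (X : rational_subspace b) : rs_norm X 0 = 0.
Proof.
apply/eqP; rewrite eq_le (rs_norm_ge0 (rs0 X)) andbT.
have [k [f [lin_f _ normX]]] := rs_rational_norm X.
rewrite normX; last exact: rs0.
by apply: bigmax_le => // i _; rewrite (linear_on0 (lin_f i)) normr0.
Qed.

Section Completion.
Variables (R : realType) (W : lmodType R) (b : nat -> W).
Variables (S : nat -> rational_subspace b) (E : completeNormedModType R) (eta : W -> E).
Hypothesis eta_completion : is_completion S eta.

Lemma completion_linear n : linear_on (S n) eta.
Proof.
by have [lin _ _] := eta_completion; move=> c x y Sx Sy; apply: lin; exists n.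
Qed.

Lemma completion_sub n x y : S n x -> S n y -> eta (x - y) = eta x - eta y.
Proof.
move=> Sx Sy; have := completion_linear (-1) Sy Sx.
by rewrite !scaleN1r addrC => ->; rewrite addrC.
Qed.

Lemma completion_norm n x : S n x -> `|eta x| = rs_norm (S n) x.
Proof. by have [_ + _] := eta_completion; apply. Qed.

Lemma completion_norm_sum n m (c : nat -> R) (v : nat -> W) :
  (forall l, (l < m)%N -> S n (v l)) ->
  `|\sum_(l < m) c l *: eta (v l)| = rs_norm (S n) (\sum_(l < m) c l *: v l).
Proof.
move=> Sv; rewrite -(linear_on_sum (@completion_linear n) c Sv).
exact/completion_norm/rs_sum.
Qed.

End Completion.

(** * Limits of successive approximations *)

Section Limit.
Variables (R : realType) (U V : lmodType R) (bU : nat -> U) (bV : nat -> V).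
Hypotheses (bU_basis : is_basis bU) (bV_basis : is_basis bV).
Variable t : nat -> triple bU bV.
Hypothesis t_enum : enumeration t.
Variables (Us : nat -> rational_subspace bU) (Vs : nat -> rational_subspace bV).
Variable Fs : nat -> U -> V.
Hypothesis UVF_constr : construction t Us Vs Fs.
Variables (Uoo Voo : completeNormedModType R) (etaU : U -> Uoo) (etaV : V -> Voo).
Hypotheses (Uoo_completion : is_completion Us etaU)
  (Voo_completion : is_completion Vs etaV).
Variable Omega : {linear Uoo -> Voo}.
Hypothesis Omega_cont : continuous Omega.
Hypothesis Omega_ext : forall n x, Us n x -> Omega (etaU x) = etaV (Fs n x).

(** Iterating the step with errors [h n] moves the [l]-th vector by a summable amount once [l < n].
    The limits satisfy both identities exactly, the second by continuity of [Omega]. *)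
Lemma simultaneous_embedding (L1 L2 : lmodType R) (P : L1 -> R) (Q : L2 -> R)
    (x : nat -> L1) (y : nat -> L2) :
  seminorm P -> seminorm Q ->
  (forall m (c : nat -> R), Q (\sum_(l < m) c l *: y l) <= P (\sum_(l < m) c l *: x l)) ->
  exists a : nat -> Uoo, forall m (c : nat -> R),
    `|\sum_(l < m) c l *: a l| = P (\sum_(l < m) c l *: x l) /\
    `|\sum_(l < m) c l *: Omega (a l)| = Q (\sum_(l < m) c l *: y l).
Proof.
move=> semiP semiQ le_QP.
pose h n : R := 2%:R^-1 ^+ n; have h_gt0 n : 0 < h n := half_gt0 R n.
pose approx := approximation Us Vs Fs P Q x y.
pose close n (s s' : nat * (nat -> U)) := forall l, (l < n)%N ->
  [/\ Us s'.1 (s.2 l), Us s'.1 (s'.2 l) &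
      rs_norm (Us s'.1) (s'.2 l - s.2 l) <= h n + h n.+1].
(* The step is made total by returning its argument when that is not an approximation. *)
have /choice[step stepP] (ns : nat * (nat * (nat -> U))) : exists s' : nat * (nat -> U),
    approx ns.1 (h ns.1) ns.2.1 ns.2.2 ->
    approx ns.1.+1 (h ns.1.+1) s'.1 s'.2 /\ close ns.1 ns.2 s'.
  have [ap|] := pselect (approx ns.1 (h ns.1) ns.2.1 ns.2.2); last by exists ns.2.
  have [k' [a' [ap' cl]]] := approximation_step bU_basis bV_basis t_enum UVF_constr
    semiP semiQ le_QP (ltW (h_gt0 _)) (h_gt0 ns.1.+1) ap.
  by exists (k', a').
(* Stage 0 concerns no vectors, so the zero sequence is a mere placeholder. *)
pose s := fix s n := if n is n'.+1 then step (n', s n') else (0%N, fun=> 0).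
have ap n : approx n (h n) (s n).1 (s n).2.
  elim: n => [|n IHn]; last by have [] := stepP (n, s n) IHn.
  split=> // c; rewrite !big_ord0 rs_norm0 ?(seminorm0 semiP) ?(seminorm0 semiQ);
    by rewrite subrr normr0 mulr0.
have cl n : close n (s n) (s n.+1) by have [] := stepP (n, s n) (ap n).
pose A n l := etaU ((s n).2 l).
(* The moves [h n + h n.+1] are at most [2 * h n], whence the bound [4 * h n]; they are controlled
   only for [n > l]. *)
have /choice[a aP] l : exists w, forall n, (l < n)%N -> `|A n l - w| <= 4 * h n.
  have [n lt_ln|w wP] := @geometric_limit R Uoo (fun n => A n l) 2 l.+1.
    have [Ua Ua' le_aa'] := cl n l lt_ln.
    rewrite /A -(completion_sub Uoo_completion Ua' Ua).
    rewrite (completion_norm Uoo_completion (n := (s n.+1).1)); last exact: rsB.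
    by apply: le_trans le_aa' _; have := h_gt0 n; rewrite /h exprS; move: (_ ^+ n) => k; lra.
  exists w => n lt_ln; apply: le_trans (wP n lt_ln) _; rewrite -/(h n).
  by have := h_gt0 n; lra.
have [C OmegaC] := continuous_linear_lipschitz Omega_cont.
have sum_close m (c : nat -> R) n : (m <= n)%N ->
    `|\sum_(l < m) c l *: A n l - \sum_(l < m) c l *: a l| <= 4 * h n * \sum_(l < m) `|c l|.
  move=> le_mn; rewrite -sumrB mulr_sumr; apply: le_trans (ler_norm_sum _ _ _) _.
  apply: ler_sum => l _; rewrite -scalerBr normrZ mulrC ler_wpM2r // aP //.
  exact: leq_trans le_mn.
exists a => m c; set D := \sum_(l < m) `|c l|.
(* Padding by zeros makes the estimates of each stage [n >= m] applicable to [m] coefficients. *)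
pose c' l := if (l < m)%N then c l else 0.
have widen n (L : lmodType R) (v : nat -> L) : (m <= n)%N ->
    \sum_(l < m) c l *: v l = \sum_(l < n) c' l *: v l.
  move=> le_mn; rewrite (big_ord_widen n (fun l => c l *: v l) le_mn) big_mkcond.
  by apply: eq_bigr => l _; rewrite /c'; case: ifP => // _; rewrite scale0r.
have D_widen n : (m <= n)%N -> \sum_(l < n) `|c' l| = D.
  move=> le_mn; rewrite /D (big_ord_widen n (fun l => `|c l|) le_mn) [RHS]big_mkcond.
  by apply: eq_bigr => l _; rewrite /c'; case: ifP => // _; rewrite normr0.
have A_P n : (m <= n)%N ->
    `| `|\sum_(l < m) c l *: A n l| - P (\sum_(l < m) c l *: x l)| <= h n * D.
  move=> le_mn; have [Ua near_P _] := ap n.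
  rewrite !(widen n) // -(D_widen n) //.
  rewrite (completion_norm_sum Uoo_completion c' Ua).
  exact: near_P c'.
have A_Q n : (m <= n)%N ->
    `| `|\sum_(l < m) c l *: Omega (A n l)| - Q (\sum_(l < m) c l *: y l)| <= h n * D.
  move=> le_mn; have [Ua _ near_Q] := ap n.
  rewrite (widen n _ (fun l => Omega (A n l))) // (widen n _ y) // -(D_widen n) //.
  have Va l : (l < n)%N -> Vs (s n).1 ((Fs (s n).1 \o (s n).2) l).
    by move=> /Ua; have [FV _ _ _] := construction_rational UVF_constr (s n).1; apply: FV.
  have -> : \sum_(l < n) c' l *: Omega (A n l) =
      \sum_(l < n) c' l *: etaV ((Fs (s n).1 \o (s n).2) l).
    by apply: eq_bigr => l _; rewrite (Omega_ext (Ua l (ltn_ord l))).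
  rewrite (completion_norm_sum Voo_completion c' Va).
  exact: near_Q c'.
have Omega_sum (v : nat -> Uoo) :
    \sum_(l < m) c l *: Omega (v l) = Omega (\sum_(l < m) c l *: v l).
  by rewrite linear_sum; apply: eq_bigr => l _; rewrite linearZ.
split.
- apply: (@eq_half_limit R _ _ (5 * D) m) => n le_mn; rewrite -/(h n).
  have := A_P n le_mn; have := sum_close m c n le_mn; rewrite -/D.
  set S1 := \sum_(l < m) _ *: A n l; set S2 := \sum_(l < m) _ *: a l => d12.
  have := ler_dist_dist S1 S2; rewrite !ler_distl; lra.
- apply: (@eq_half_limit R _ _ ((1 + `|C| * 4) * D) m) => n le_mn; rewrite -/(h n).
  have := A_Q n le_mn; have := sum_close m c n le_mn; rewrite -/D !Omega_sum.
  set S1 := \sum_(l < m) _ *: A n l; set S2 := \sum_(l < m) _ *: a l => d12.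
  have : `|Omega S1 - Omega S2| <= `|C| * (4 * h n * D).
    rewrite -linearB (le_trans (OmegaC _)) // (le_trans (ler_wpM2r _ (ler_norm C))) //.
    by rewrite ler_wpM2l.
  have := ler_dist_dist (Omega S1) (Omega S2); rewrite !ler_distl; lra.
Qed.

End Limit.

(** * Embedding a nonexpansive operator *)

Lemma sum_even (R : realType) (L : lmodType R) (m : nat) (c : nat -> R) (v : nat -> L) :
  \sum_(l < m.*2) (if odd l then 0 else c l./2) *: v l = \sum_(l < m) c l *: v l.*2.
Proof.
elim: m => [|m IHm]; first by rewrite !big_ord0.
by rewrite doubleS !big_ord_recr /= IHm /= odd_double doubleK scale0r addr0.
Qed.

Theorem theorem4p3 (R : realType)
  (U V : lmodType R) (bU : nat -> U) (bV : nat -> V)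
  (bU_basis : is_basis bU) (bV_basis : is_basis bV)
  (t : nat -> triple bU bV) (t_enum : enumeration t)
  (Us : nat -> rational_subspace bU) (Vs : nat -> rational_subspace bV)
  (Fs : nat -> U -> V) (UVF_constr : construction t Us Vs Fs)
  (Uoo Voo : completeNormedModType R) (etaU : U -> Uoo) (etaV : V -> Voo)
  (Uoo_completion : is_completion Us etaU)
  (Voo_completion : is_completion Vs etaV)
  (Omega : {linear Uoo -> Voo}) (Omega_cont : continuous Omega)
  (Omega_ext : forall n x, Us n x -> Omega (etaU x) = etaV (Fs n x))
  (* identification of Uoo and Voo with the Gurarii space *)
  (G : completeNormedModType R) (G_gurarii : gurarii G)
  (phi : {linear Uoo -> G}) (phi_isom : norm_preserving phi)
  (phi_surj : range phi = [set: G])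
  (psi : {linear Voo -> G}) (psi_isom : norm_preserving psi)
  (psi_surj : range psi = [set: G])
  (OmegaG : {linear G -> G})
  (OmegaG_def : forall u, OmegaG (phi u) = psi (Omega u))
  (X Y : completeNormedModType R)
  (X_separable : separable X) (Y_separable : separable Y)
  (T : {linear X -> Y}) (T_nonexpansive : nonexpansive T) :
  exists (i : {linear X -> G}) (j : {linear Y -> G}),
    [/\ norm_preserving i, norm_preserving j
      & forall x, OmegaG (i x) = j (T x)].
Proof.
have [u u_dense] := separable_sequence X_separable.
have [v v_dense] := separable_sequence Y_separable.
(* With the l1-sum norm, the map sending a pair to [T z.1 + z.2] is nonexpansive. *)
pose P (z : X * Y) : R := `|z.1| + `|z.2|.
have semiP : seminorm P.
  split=> [z z'|c z]; rewrite /P /=; last by rewrite !normrZ mulrDr.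
  by rewrite addrACA lerD // ler_normD.
have semiQ : seminorm (fun z : Y => `|z|).
  by split=> [z z'|c z]; [exact: ler_normD|exact: normrZ].
(* Even positions list the dense sequence of [X], odd positions that of [Y]; thus the odd terms of
   [y] alone are dense in [Y]. *)
pose x l : X * Y := if odd l then (0, v l./2) else (u l./2, 0).
pose y l := T (x l).1 + (x l).2.
have [|a aP] := simultaneous_embedding bU_basis bV_basis t_enum UVF_constr
  Uoo_completion Voo_completion Omega_cont Omega_ext (x := x) (y := y) semiP semiQ.
  move=> m c; have -> : \sum_(l < m) c l *: y l =
      T (\sum_(l < m) c l *: x l).1 + (\sum_(l < m) c l *: x l).2.
    rewrite !raddf_sum /= -big_split /=; apply: eq_bigr => l _.
    by rewrite linearZ scalerDr.
  by apply: le_trans (ler_normD _ _) _; rewrite /P lerD2r.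
have [m c|i [i_isom iu]] := isometric_extension (x := u) (a := fun l => a l.*2) u_dense.
  (* Coefficients supported on even positions leave the component in [Y] zero, so [P] reduces to the
     norm of [X]. *)
  have [+ _] := aP m.*2 (fun l => if odd l then 0 else c l./2).
  rewrite !sum_even => ->; rewrite /P !raddf_sum /= [X in _ + `|X|]big1 => [|l _].
    rewrite normr0 addr0; congr `|_|; apply: eq_bigr => l _.
    by rewrite /x odd_double doubleK.
  by rewrite /x odd_double scaler0.
have [z eps eps_gt0|m c|j [j_isom jy]] :=
    isometric_extension (x := y) (a := fun l => Omega (a l)).
- have [l zl] := v_dense z eps eps_gt0; exists l.*2.+1.
  by rewrite /y /x /= odd_double /= uphalf_double linear0 add0r.
- by have [_] := aP m c.
have [C OmegaC] := continuous_linear_lipschitz Omega_cont.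
(* Both sides agree on the dense [u l] and are Lipschitz, with constants [|C|] and 1. *)
have Omega_i z : Omega (i z) = j (T z).
  apply/eqP; rewrite -subr_eq0 -normr_le0.
  apply: (@le_half_limit R _ _ (`|C| + 1) 0%N) => n _; rewrite add0r.
  have [l /ltW zl] := u_dense z _ (half_gt0 R n).
  have Omega_u : Omega (i (u l)) = j (T (u l)).
    by rewrite iu -jy /y /x odd_double doubleK addr0.
  rewrite mulrDl mul1r; apply: le_trans (ler_distD (Omega (i (u l))) _ _) _.
  apply: lerD.
    rewrite -!linearB (le_trans (OmegaC _)) // i_isom.
    by rewrite (le_trans (ler_wpM2r _ (ler_norm C))) // ler_wpM2l.
  rewrite Omega_u -!linearB j_isom (le_trans (T_nonexpansive _)) //.
  by rewrite distrC.
exists (phi \o i), (psi \o j); split=> [z|z|z] /=.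
- by rewrite phi_isom.
- by rewrite psi_isom.
- by rewrite OmegaG_def Omega_i.
Qed.
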